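(* Let $n\ge 2$, let $A_1,\dots,A_d\in\mathfrak{so}(n)$ ($d\ge 1$), and let $B_{i_1j_1},\dots,B_{i_ej_e}$ be elements of the standard basis $\{B_{ij}=E_{ij}-E_{ji}:1\le i<j\le n\}$ of $\mathfrak{so}(n)$. Let $\mathrm{G}_{\rm drift}$ be the undirected graph on $\mathrm{V}=\{1,\dots,n\}$ in which $\{i,j\}$ ($i\neq j$) is an edge iff $[A_s]_{ij}=-[A_s]_{ji}\neq 0$ for some $s\in\{1,\dots,d\}$, and let $\mathrm{G}_{\rm contr}$ be the undirected graph on $\mathrm{V}$ with edge set $\{\{i_1,j_1\},\dots,\{i_e,j_e\}\}$. If each connected component of $\mathrm{G}_{\rm contr}$ contains at least three nodes and the union graph $\mathrm{G}_{\rm drift}\cup\mathrm{G}_{\rm contr}$ (same node set, union of edge sets) is connected, then the system $$\dot X(t)=\mathsf B_0X(t)+\Big(\sum_{i=1}^m u_i(t)\mathsf B_i\Big)X(t),\qquad X(0)=X_0,$$ is structurally controllable on $\mathrm{SO}(n)$ with respect to the pair of zero patterns $\big(\Sigma_{\rm r}(\{A_1,\dots,A_d\}),\Sigma_{\rm f}(\{B_{i_1j_1},\dots,B_{i_ej_e}\})\big)$.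
   Context: $E_{ij}$ denotes the $n\times n$ matrix with $(i,j)$ entry $1$ and all other entries $0$. For a finite subset $\{g_1,\dots,g_k\}$ of a real Lie algebra $\mathfrak g$, the free zero pattern is $\Sigma_{\rm f}(\{g_1,\dots,g_k\})=\{\sum_s l_sg_s: l_s\in\mathbb R\}$ and the rigid zero pattern is $\Sigma_{\rm r}(\{g_1,\dots,g_k\})=\{\sum_s l_sg_s: l_s\in\mathbb R,\ l_s\neq 0 \text{ for all } s\}$. For a connected matrix Lie group $\mathbf G$ with Lie algebra $\mathfrak g$, consider $\dot X=\mathsf B_0X+(\sum_{i=1}^m u_i\mathsf B_i)X$ with $X(t)\in\mathbf G$, $\mathsf B_i\in\mathfrak g$, and piecewise continuous real controls $u_i$. The attainable set $\mathcal R(I)$ is the set of all $X(T)$, $T\ge 0$, over all such controls, starting from $X(0)=I$. The system is controllable if $\mathcal R(I)=\mathbf G$ and accessible if $\mathcal R(I)$ has an interior point in $\mathbf G$. The system is structurally controllable (resp. accessible) on $\mathbf G$ with respect to a pair $(\Sigma_{\rm r}(\mathfrak g_\alpha),\Sigma_{\rm f}(\mathfrak g_\beta))$ if there exist an integer $m\ge1$, $\mathsf B_0\in\Sigma_{\rm r}(\mathfrak g_\alpha)$ and $\mathsf B_1,\dots,\mathsf B_m\in\Sigma_{\rm f}(\mathfrak g_\beta)$ such that the resulting system is controllable (resp. accessible) on $\mathbf G$. *)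

(* Defs.v *)
From HB Require Import structures.
From mathcomp Require Import all_boot all_order all_algebra.
From mathcomp Require Import all_classical all_reals all_analysis.
Set Implicit Arguments. Unset Strict Implicit. Unset Printing Implicit Defensive.
Import Order.TTheory GRing.Theory Num.Theory.
Import numFieldNormedType.Exports.
Local Open Scope classical_set_scope.
Local Open Scope ring_scope.

Section Defs.
Variable R : realType.

Definition in_so (n : nat) (A : 'M[R]_n) : Prop := A^T = - A.

Definition in_SO (n : nat) (X : 'M[R]_n) : Prop := X *m X^T = 1%:M /\ \det X = 1.

Definition Bbasis (n : nat) (i j : 'I_n) : 'M[R]_n := delta_mx i j - delta_mx j i.

(* Zero patterns of the finite SET {g_1,...,g_k} given by a list (duplicates removed). *)
Definition free_pattern (n : nat) (gs : seq 'M[R]_n) : set 'M[R]_n :=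
  [set B | exists l : 'M[R]_n -> R, B = \sum_(g <- undup gs) l g *: g].
Definition rigid_pattern (n : nat) (gs : seq 'M[R]_n) : set 'M[R]_n :=
  [set B | exists l : 'M[R]_n -> R,
     (forall g, g \in gs -> l g != 0) /\ B = \sum_(g <- undup gs) l g *: g].

Definition piecewise_continuous (u : R -> R) (T : R) : Prop :=
  exists s : seq R,
    (forall t, 0 < t < T -> t \notin s -> u x @[x --> t] --> u t) /\
    (forall t, 0 <= t < T -> exists l : R, u x @[x --> t^'+] --> l) /\
    (forall t, 0 < t <= T -> exists l : R, u x @[x --> t^'-] --> l).

Definition is_trajectory (n m : nat) (B0 : 'M[R]_n) (Bs : 'I_m -> 'M[R]_n)
    (u : 'I_m -> R -> R) (T : R) (X : R -> 'M[R]_n) : Prop :=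
  X 0 = 1%:M /\
  (forall t, 0 <= t <= T -> in_SO (X t)) /\
  (forall i j, {within `[0, T], continuous (fun t => X t i j)}) /\
  exists s : seq R, forall t, 0 < t < T -> t \notin s ->
    forall i j, is_derive t 1 (fun t' => X t' i j)
                  (((B0 + \sum_(k < m) u k t *: Bs k) *m X t) i j).

Definition attainable (n m : nat) (B0 : 'M[R]_n) (Bs : 'I_m -> 'M[R]_n) : set 'M[R]_n :=
  [set Y | exists (T : R) (u : 'I_m -> R -> R) (X : R -> 'M[R]_n),
     0 <= T /\ (forall k, piecewise_continuous (u k) T) /\
     is_trajectory B0 Bs u T X /\ X T = Y].

Definition controllable_SO (n m : nat) (B0 : 'M[R]_n) (Bs : 'I_m -> 'M[R]_n) : Prop :=
  forall Y : 'M[R]_n, in_SO Y -> attainable B0 Bs Y.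

Definition structurally_controllable_SO (n : nat) (Aset Bset : seq 'M[R]_n) : Prop :=
  exists (m : nat) (B0 : 'M[R]_n) (Bs : 'I_m -> 'M[R]_n),
    (1 <= m)%N /\ rigid_pattern Aset B0 /\ (forall k, free_pattern Bset (Bs k)) /\
    controllable_SO B0 Bs.

Definition drift_rel (n : nat) (As : seq 'M[R]_n) : rel 'I_n :=
  fun i j => (i != j) && has (fun A : 'M[R]_n => A i j != 0) As.
Definition contr_rel (n : nat) (E : seq ('I_n * 'I_n)) : rel 'I_n :=
  fun i j => (i != j) && (((i, j) \in E) || ((j, i) \in E)).
Definition union_rel (T : Type) (e1 e2 : rel T) : rel T := fun i j => e1 i j || e2 i j.

Definition graph_connected (n : nat) (e : rel 'I_n) : Prop :=
  forall i j, connect e i j.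
Definition components_ge3 (n : nat) (e : rel 'I_n) : Prop :=
  forall i, (3 <= #|[set j | connect e i j]|)%N.

End Defs.

(* Main.v *)
Require Import Defs.
From HB Require Import structures.
From mathcomp Require Import all_boot all_order all_algebra all_fingroup.
From mathcomp Require Import all_classical all_reals all_analysis.
From mathcomp Require Import ring lra.
Set Implicit Arguments. Unset Strict Implicit. Unset Printing Implicit Defensive.
Import Order.TTheory GRing.Theory Num.Theory.
Import numFieldNormedType.Exports.
Local Open Scope classical_set_scope.
Local Open Scope ring_scope.

(* Choose the drift coefficients generically, so that [B0] is nonzero on every drift edge,
   and let [S] be the semigroup generated by the [expmx (t *: (B0 + \sum_k u_k *: B_k))] with
   [0 <= t].

   Density.  By recurrence in the compact group [SO(n)], the closure of [S] is a group, so by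
   the Chernoff formula the [A] with all [expmx (t *: A)] in the closure form a subspace stable
   under conjugation.  It contains [B0] and every [B0 + B_e], hence the [B_e], hence [B_ij] for
   [i, j] in one component of the control graph.  Conjugating [B0] by a half-turn in the plane
   [(k, l)] changes the sign of the entries crossing the cut [{k, l}].  As components have at
   least three nodes, four such cuts isolate [B_ij] for each drift edge joining two components.
   So all [B_ij] are obtained, and maximizing a weighted trace shows that the closure is [SO(n)].

   Exactness.  By density, some conjugate by [S] of [+- B_e + v *: B0] is close to [B_pq]; the
   product of the corresponding exponentials over all [p != q], with the durations as parameters,
   is a chart in [S] whose derivative is close to [M |-> M - M^T].  A fixed point argument then
   shows that it covers an open set, and [S], being dense, is all of [SO(n)]. *)

Section MatrixNorm.
Variable R : realFieldType.

Lemma ler_coord_mx_norm m n (A : 'M[R]_(m, n)) i j : `|A i j| <= `|A|.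
Proof.
by rewrite [leRHS]/Num.norm/= mx_normrE; exact: (le_bigmax _ _ (i, j)).
Qed.

Lemma ler_mx_norm m n (A : 'M[R]_(m, n)) e :
  0 <= e -> (forall i j, `|A i j| <= e) -> `|A| <= e.
Proof.
by move=> e0 Ae; rewrite [leLHS]/Num.norm/= mx_normrE; apply: bigmax_le.
Qed.

Lemma ler_mx_normM m n p (A : 'M[R]_(m, n)) (B : 'M[R]_(n, p)) :
  `|A *m B| <= n%:R * `|A| * `|B|.
Proof.
apply: ler_mx_norm => [|i j]; first by rewrite !mulr_ge0.
rewrite mxE (le_trans (ler_norm_sum _ _ _))//.
rewrite (@le_trans _ _ (\sum_(k < n) `|A| * `|B|))//.
  by apply: ler_sum => k _; rewrite normrM ler_pM// ler_coord_mx_norm.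
by rewrite sumr_const card_ord -mulrA mulr_natl.
Qed.

Lemma ler_mx_norm_tr m n (A : 'M[R]_(m, n)) : `|A^T| <= `|A|.
Proof. by apply: ler_mx_norm => // i j; rewrite mxE ler_coord_mx_norm. Qed.

Lemma ler_mx_norm1 n : `|1%:M : 'M[R]_n| <= 1.
Proof.
by apply: ler_mx_norm => // i j; rewrite mxE; case: eqP; rewrite ?normr1 ?normr0.
Qed.

End MatrixNorm.

Section MatrixConvergence.
Variables (R : numFieldType) (T : Type) (F : set_system T).
Context {FF : Filter F}.

Lemma cvg_mx m n (f : T -> 'M[R]_(m, n)) (A : 'M[R]_(m, n)) :
  (forall i j, f x i j @[x --> F] --> A i j) -> f @ F --> A.
Proof.
move=> fA U [P AP PU]; apply: (filterS (fun x => PU (f x))).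
apply: filter_forall => i; apply: filter_forall => j.
exact: fA (AP i j).
Qed.

Lemma cvg_coord m n (f : T -> 'M[R]_(m, n)) (A : 'M[R]_(m, n)) i j :
  f @ F --> A -> f x i j @[x --> F] --> A i j.
Proof. by move=> fA; exact: cvg_comp fA (@coord_continuous _ _ _ i j A). Qed.

Lemma cvg_mulmx m n p (f : T -> 'M[R]_(m, n)) (g : T -> 'M[R]_(n, p))
    (A : 'M[R]_(m, n)) (B : 'M[R]_(n, p)) :
  f @ F --> A -> g @ F --> B -> f x *m g x @[x --> F] --> A *m B.
Proof.
move=> fA gB; apply: cvg_mx => i j; rewrite mxE; under eq_cvg do rewrite mxE.
apply: cvg_big => [|k _]; first exact: add_continuous.
by apply: cvgM; exact: cvg_coord.
Qed.

Lemma cvg_trmx m n (f : T -> 'M[R]_(m, n)) (A : 'M[R]_(m, n)) :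
  f @ F --> A -> (f x)^T @[x --> F] --> A^T.
Proof.
move=> fA; apply: cvg_mx => i j; rewrite mxE; under eq_cvg do rewrite mxE.
exact: cvg_coord.
Qed.

Lemma cvg_determinant n (f : T -> 'M[R]_n) (A : 'M[R]_n) :
  f @ F --> A -> \det (f x) @[x --> F] --> \det A.
Proof.
move=> fA; apply: cvg_big => [|s _]; first exact: add_continuous.
apply: cvgM; first exact: cvg_cst.
by apply: cvg_big => [|i _]; [exact: mul_continuous|exact: cvg_coord].
Qed.

Lemma cvg_mxtrace n (f : T -> 'M[R]_n) (A : 'M[R]_n) :
  f @ F --> A -> \tr (f x) @[x --> F] --> \tr A.
Proof.
move=> fA; apply: cvg_big => [|i _]; first exact: add_continuous.
exact: cvg_coord.
Qed.

End MatrixConvergence.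

Lemma bounded_closed_mx_compact (R : realType) m n (K : set 'M[R]_(m, n)) M :
  (forall A, K A -> `|A| <= M) -> closed K -> compact K.
Proof.
move=> KM clK.
have vec_cont : continuous (@vec_mx R m n).
  move=> v; apply: (@cvg_mx _ _ (nbhs v)) => i j; rewrite mxE; under eq_cvg do rewrite mxE.
  exact: coord_continuous.
have -> : K = vec_mx @` (vec_mx @^-1` K).
  apply/seteqP; split=> [A KA|_ [v Kv <-]//].
  by exists (mxvec A); rewrite /= mxvecK.
apply: continuous_compact; first exact: continuous_subspaceT.
apply: bounded_closed_compact; last by apply: preimage_closed => // v _; exact: vec_cont.
exists M; split; first exact: num_real.
move=> r /ltW Mr v /KM vM; apply: (le_trans _ Mr).
apply: ler_mx_norm => [|i k]; first exact: le_trans vM.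
rewrite ord1 -(vec_mxK v); case/mxvec_indexP: k => a b.
by rewrite mxvecE (le_trans _ vM)// ler_coord_mx_norm.
Qed.

(* Matrices are normed modules and complete uniform spaces in the library, but the
   join of the two structures is not declared there. *)
HB.instance Definition _ (R : realType) m n :=
  Uniform_isComplete.Build 'M[R]_(m, n) cauchy_cvg.

Lemma closure_normP (R : realType) (V : normedModType R) (S : set V) x :
  closure S x <-> forall e, 0 < e -> exists2 y, S y & `|x - y| < e.
Proof.
split=> [Sx e e0|Sx U /nbhs_ballP[e e0 xeU]].
  by have [y [Sy xy]] := Sx _ (nbhsx_ballx x e e0); exists y; rewrite // -ball_normE in xy *.
by have [y Sy xy] := Sx e e0; exists y; split=> //; apply: xeU; rewrite -ball_normE.
Qed.

Section MatrixDerivative.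
Variable R : realType.
Implicit Type t : R.

Lemma is_derive_mxP m n (F : R -> 'M[R]_(m, n)) t A :
  is_derive t 1 F A <-> forall i j, is_derive t 1 (fun s => F s i j) (A i j).
Proof.
split=> [[dF <-] i j|dF].
  by split; [move/derivable_mxP: dF|rewrite derive_mx// mxE].
have dF' : derivable F t 1 by apply/derivable_mxP => i j; case: (dF i j).
split=> //; rewrite derive_mx//; apply/matrixP => i j; rewrite mxE.
by case: (dF i j).
Qed.

Lemma is_derive_mulmx m n p (F : R -> 'M[R]_(m, n)) (G : R -> 'M[R]_(n, p)) t A B :
  is_derive t 1 F A -> is_derive t 1 G B ->
  is_derive t 1 (fun s => F s *m G s) (A *m G t + F t *m B).
Proof.
move=> /is_derive_mxP dF /is_derive_mxP dG; apply/is_derive_mxP => i j.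
rewrite !mxE -big_split /=.
rewrite (_ : (fun s => _) = \sum_(k < n) ((fun s => F s i k) * (fun s => G s k j))).
  apply: is_derive_sum => k.
  apply: is_derive_eq (is_deriveM (dF i k) (dG k j)) _.
  by rewrite addrC; congr (_ + _); exact: mulrC.
by apply/funext => s; rewrite mxE fct_sumE.
Qed.

Lemma is_derive_mulmxl m n p (A : 'M[R]_(m, n)) (G : R -> 'M[R]_(n, p)) t B :
  is_derive t 1 G B -> is_derive t 1 (fun s => A *m G s) (A *m B).
Proof.
move=> dG; apply: is_derive_eq; first exact: is_derive_mulmx (is_derive_cst A t 1) dG.
by rewrite mul0mx add0r.
Qed.

Lemma is_derive_mulmxr m n p (F : R -> 'M[R]_(m, n)) (B : 'M[R]_(n, p)) t A :
  is_derive t 1 F A -> is_derive t 1 (fun s => F s *m B) (A *m B).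
Proof.
move=> dF; apply: is_derive_eq; first exact: is_derive_mulmx dF (is_derive_cst B t 1).
by rewrite mulmx0 addr0.
Qed.

Lemma is_derive_trmx m n (F : R -> 'M[R]_(m, n)) t A :
  is_derive t 1 F A -> is_derive t 1 (fun s => (F s)^T) A^T.
Proof.
move=> /is_derive_mxP dF; apply/is_derive_mxP => i j.
by rewrite mxE; under eq_fun do rewrite mxE; exact: dF.
Qed.

Lemma is_deriveZl (V : normedModType R) (a : R -> R) t (da : R) (v : V) :
  is_derive t 1 a da -> is_derive t 1 (fun s => a s *: v) (da *: v).
Proof.
move=> [da_cvg <-].
have av_cvg : h^-1 *: ((a (h *: 1 + t) - a t) *: v) @[h --> 0^'] --> 'D_1 a t *: v.
  under eq_cvg do rewrite scalerA; exact: cvgZr_tmp.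
split; first by apply/cvg_ex; exists ('D_1 a t *: v); under eq_cvg do rewrite -scalerBl.
by apply: cvg_lim => //; under eq_cvg do rewrite -scalerBl.
Qed.

Lemma is_derive_mx0_cst m n (F : R -> 'M[R]_(m, n)) :
  (forall t, is_derive t 1 F 0) -> forall s t, F s = F t.
Proof.
move=> dF s t; apply/matrixP => i j.
apply: (is_derive_0_is_cst (f := fun s => F s i j)) => x.
by have /is_derive_mxP/(_ i j) := dF x; rewrite mxE.
Qed.

End MatrixDerivative.

Lemma is_derive_linear_approx (R : realType) (V : normedModType R) (f : R -> V) (x : R) (D : V) :
  is_derive x 1 f D ->
  forall e, 0 < e -> \forall h \near 0, `|f (x + h) - f x - h *: D| <= e * `|h|.
Proof.
move=> [/derivable_nbhs df <-] e e0; move/eqaddoP: df => /(_ e e0).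
apply: filterS => h /=; rewrite opprD addrA.
by have -> : x + h = h *: (1 : R^o) + x by rewrite [_ *: _]mulr1 addrC.
Qed.

Section MatrixExponential.
Variables (R : realType) (n : nat).
Implicit Types (A B : 'M[R]_n) (F : R -> 'M[R]_n) (s t : R).

Definition expmx_coeff A (k : nat) : 'M[R]_n := k`!%:R^-1 *: A ^+ k.

Definition expmx A : 'M[R]_n := limn (series (expmx_coeff A)).

Lemma ler_mx_normX A k : `|A ^+ k| <= (n%:R * `|A|) ^+ k.
Proof.
elim: k => [|k IH]; first by rewrite !expr0 ler_mx_norm1.
by rewrite !exprS (le_trans (ler_mx_normM _ _))// ler_wpM2l// mulr_ge0.
Qed.

Lemma cvg_expmx A : series (expmx_coeff A) @ \oo --> expmx A.
Proof.
apply: normed_cvg; apply: series_le_cvg (is_cvg_series_exp_coeff (n%:R * `|A|)).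
- by move=> k; exact: normr_ge0.
- by move=> k; apply: exp_coeff_ge0; rewrite mulr_ge0.
- move=> k; rewrite /expmx_coeff /exp_coeff /= normrZ normfV normr_nat mulrC.
  by rewrite ler_wpM2r// ler_mx_normX.
Qed.

Lemma expmx0 : expmx 0 = 1%:M.
Proof.
apply: cvg_lim => //; rewrite -(cvg_shiftn 1); apply: cvg_near_cst.
apply: nearW => k /=; rewrite /series /= addn1 big_nat_recl //= big1 => [|j _].
  by rewrite /expmx_coeff /= invr1 scale1r addr0.
by rewrite /expmx_coeff /= exprS mul0r scaler0.
Qed.

Lemma expmx_comm A B : A *m B = B *m A -> A *m expmx B = expmx B *m A.
Proof.
move=> AB.
have cAB : A *m series (expmx_coeff B) k @[k --> \oo] --> A *m expmx B.
  by apply: cvg_mulmx; [exact: cvg_cst|exact: cvg_expmx].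
rewrite -(cvg_lim _ cAB)//; apply: cvg_lim => //.
have -> : (fun k => A *m series (expmx_coeff B) k) =
          (fun k => series (expmx_coeff B) k *m A).
  apply/funext => k; rewrite /series /= mulmx_sumr mulmx_suml.
  apply: eq_bigr => j _; rewrite /expmx_coeff /= -scalemxAr -scalemxAl.
  by rewrite !mulmxE; congr (_ *: _); apply: commrX; rewrite /GRing.comm -!mulmxE.
by apply: cvg_mulmx; [exact: cvg_expmx|exact: cvg_cst].
Qed.

Lemma exprmxZ t A k : (t *: A) ^+ k = t ^+ k *: A ^+ k.
Proof.
elim: k => [|k IH]; first by rewrite !expr0 scale1r.
by rewrite !exprS IH -!mulmxE -scalemxAl -scalemxAr scalerA.
Qed.

Lemma cvg_pseries_expmx A B t i j :
  pseries (fun k => (B *m A ^+ k) i j / k`!%:R) t @ \oo --> (B *m expmx (t *: A)) i j.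
Proof.
have -> : pseries (fun k => (B *m A ^+ k) i j / k`!%:R) t =
          (fun k => (B *m series (expmx_coeff (t *: A)) k) i j).
  apply/funext => k; rewrite /pseries /series /= mulmx_sumr summxE.
  apply: eq_bigr => l _; rewrite /expmx_coeff exprmxZ -!scalemxAr !mxE.
  by rewrite -mulrA mulrC -mulrA.
by apply: cvg_coord; apply: cvg_mulmx; [exact: cvg_cst|exact: cvg_expmx].
Qed.

Lemma pseries_diffs_expmx A B i j :
  pseries_diffs (fun k => (B *m A ^+ k) i j / k`!%:R) =
  (fun k => (B *m A *m A ^+ k) i j / k`!%:R).
Proof.
apply/funext => k; rewrite /pseries_diffs factS natrM invfM exprS -mulmxE mulmxA.
by rewrite mulrCA mulVKf // pnatr_eq0.
Qed.

Lemma is_derive_expmx A t :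
  is_derive t 1 (fun s => expmx (s *: A)) (A *m expmx (t *: A)).
Proof.
apply/is_derive_mxP => i j.
pose c B k := (B *m A ^+ k) i j / k`!%:R.
have cvg_c B s : pseries (c B) s @ \oo --> (B *m expmx (s *: A)) i j.
  exact: cvg_pseries_expmx.
have is_cvg_c B s : cvgn (pseries (c B) s) by apply/cvg_ex; eexists; exact: cvg_c.
have diffs_c B : pseries_diffs (c B) = c (B *m A) by exact: pseries_diffs_expmx.
have -> : (fun s => expmx (s *: A) i j) = (fun s => limn (pseries (c 1%:M) s)).
  by apply/funext => s; rewrite -[expmx _]mul1mx; apply/esym/cvg_lim.
rewrite -(cvg_lim _ (cvg_c A t))// -[in c A](mul1mx A) -diffs_c.
apply: (@pseries_snd_diffs _ _ (`|t| + 1)); rewrite ?diffs_c//.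
by rewrite [ltRHS]ger0_norm ?addr_ge0 // ltrDl.
Qed.

Lemma is_derive_expmxr A t :
  is_derive t 1 (fun s => expmx (s *: A)) (expmx (t *: A) *m A).
Proof.
apply: is_derive_eq (is_derive_expmx A t) _; apply: expmx_comm.
by rewrite -scalemxAl -scalemxAr.
Qed.

Lemma expmxVl A : expmx (- A) *m expmx A = 1%:M.
Proof.
have dN t : is_derive t 1 (fun s => expmx (s *: - A) *m expmx (s *: A)) 0.
  apply: is_derive_eq.
    exact: is_derive_mulmx (is_derive_expmxr _ t) (is_derive_expmx _ t).
  by rewrite mulmxN mulNmx mulmxA addNr.
by have := is_derive_mx0_cst dN 1 0; rewrite !scale1r !scale0r expmx0 mulmx1.
Qed.

Lemma expmxVr A : expmx A *m expmx (- A) = 1%:M.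
Proof. exact/mulmx1C/expmxVl. Qed.

(* [expmx (- t *: A)] inverts [expmx (t *: A)], so [F] is determined by
   differentiating [expmx (- t *: A) *m F t]. *)
Lemma linear_ode_unique A F : (forall t, is_derive t 1 F (A *m F t)) ->
  forall t, F t = expmx (t *: A) *m F 0.
Proof.
move=> dF t.
have dNF s : is_derive s 1 (fun u => expmx (u *: - A) *m F u) 0.
  apply: is_derive_eq; first exact: is_derive_mulmx (is_derive_expmxr _ s) (dF s).
  by rewrite mulmxN mulNmx mulmxA addNr.
have := is_derive_mx0_cst dNF t 0; rewrite scale0r expmx0 mul1mx => <-.
by rewrite mulmxA scalerN expmxVr mul1mx.
Qed.

Lemma expmxD A B : A *m B = B *m A -> expmx (A + B) = expmx A *m expmx B.
Proof.
move=> AB.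
have dAB t : is_derive t 1 (fun s => expmx (s *: A) *m expmx (s *: B))
    ((A + B) *m (expmx (t *: A) *m expmx (t *: B))).
  apply: is_derive_eq.
    exact: is_derive_mulmx (is_derive_expmx _ t) (is_derive_expmx _ t).
  rewrite mulmxDl !mulmxA; congr (_ + _ *m _); apply/esym/expmx_comm.
  by rewrite -scalemxAl -scalemxAr AB.
have := linear_ode_unique dAB 1.
by rewrite !scale1r !scale0r expmx0 !mulmx1 => ->.
Qed.

Lemma expmxDl A s t : expmx ((s + t) *: A) = expmx (s *: A) *m expmx (t *: A).
Proof. by rewrite scalerDl expmxD// -!scalemxAl -!scalemxAr !scalerA mulrC. Qed.

Lemma expmxX A k : expmx A ^+ k = expmx (k%:R *: A).
Proof.
elim: k => [|k IH]; first by rewrite scale0r expmx0.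
by rewrite exprS IH -mulmxE -natr1 addrC expmxDl scale1r.
Qed.

Lemma expmx_conj A P Q : Q *m P = 1%:M -> P *m Q = 1%:M ->
  expmx (P *m A *m Q) = P *m expmx A *m Q.
Proof.
move=> QP PQ.
have dPQ t : is_derive t 1 (fun s => P *m expmx (s *: A) *m Q)
    (P *m A *m Q *m (P *m expmx (t *: A) *m Q)).
  apply: is_derive_eq.
    by apply: is_derive_mulmxr; apply: is_derive_mulmxl; exact: is_derive_expmx.
  by rewrite !mulmxA -[_ *m Q *m P]mulmxA QP mulmx1.
by have := linear_ode_unique dPQ 1; rewrite !scale1r scale0r expmx0 mulmx1 PQ mulmx1.
Qed.

Lemma expmx_tr A : expmx A^T = (expmx A)^T.
Proof.
have dT t : is_derive t 1 (fun s => (expmx (s *: A))^T) (A^T *m (expmx (t *: A))^T).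
  by rewrite -trmx_mul; apply: is_derive_trmx; exact: is_derive_expmxr.
by have := linear_ode_unique dT 1; rewrite !scale1r scale0r expmx0 trmx1 mulmx1.
Qed.

Lemma expmx_continuous A : continuous (fun t => expmx (t *: A)).
Proof.
move=> t; apply/differentiable_continuous/derivable1_diffP.
by case: (is_derive_expmx A t).
Qed.

End MatrixExponential.

(* Keeps unification from unfolding [expmx] down to limits of series. *)
#[local] Opaque expmx.

Section SpecialOrthogonal.
Variables (R : realType) (n : nat).
Implicit Types (A B P Q X Y : 'M[R]_n).

Lemma SO_trmxr X : in_SO X -> X *m X^T = 1%:M.
Proof. by case. Qed.

Lemma SO_trmxl X : in_SO X -> X^T *m X = 1%:M.
Proof. by move/SO_trmxr; exact: mulmx1C. Qed.

Lemma SO1 : in_SO (1%:M : 'M[R]_n).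
Proof. by split; rewrite ?trmx1 ?mulmx1 ?det1. Qed.

Lemma SO_tr X : in_SO X -> in_SO X^T.
Proof. by move=> XSO; split; rewrite ?trmxK ?det_tr; [exact: SO_trmxl|case: XSO]. Qed.

Lemma SO_mul X Y : in_SO X -> in_SO Y -> in_SO (X *m Y).
Proof.
move=> XSO YSO; split; last by rewrite det_mulmx XSO.2 YSO.2 mulr1.
by rewrite trmx_mul mulmxA -[X *m Y *m _]mulmxA SO_trmxr// mulmx1 SO_trmxr.
Qed.

Lemma SO_exp X k : in_SO X -> in_SO (X ^+ k).
Proof.
by move=> XSO; elim: k => [|k IH]; [exact: SO1|rewrite exprS; exact: SO_mul].
Qed.

Lemma SO_expmx A : in_so A -> in_SO (expmx A).
Proof.
move=> soA; have E_tr B : in_so B -> (expmx B)^T = expmx (- B).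
  by rewrite -expmx_tr => ->.
split; first by rewrite E_tr// expmxVr.
have -> : A = 2^-1 *: A + 2^-1 *: A by rewrite -scalerDl -div1r -splitr scale1r.
rewrite expmxD// det_mulmx -[X in _ * X]det_tr -det_mulmx E_tr ?expmxVr ?det1//.
by rewrite /in_so linearZ /= soA scalerN.
Qed.

Lemma so0 : in_so (0 : 'M[R]_n).
Proof. by rewrite /in_so trmx0 oppr0. Qed.

Lemma soD A B : in_so A -> in_so B -> in_so (A + B).
Proof. by rewrite /in_so linearD /= => -> ->; rewrite opprD. Qed.

Lemma soZ c A : in_so A -> in_so (c *: A).
Proof. by rewrite /in_so linearZ /= => ->; rewrite scalerN. Qed.

Lemma so_sum (I : Type) (r : seq I) (P : pred I) (F : I -> 'M[R]_n) :
  (forall i, P i -> in_so (F i)) -> in_so (\sum_(i <- r | P i) F i).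
Proof. by move=> soF; elim/big_ind: _ => //; [exact: so0|exact: soD]. Qed.

Lemma SO_norm X : in_SO X -> `|X| <= 1.
Proof.
move=> XSO; apply: ler_mx_norm => // i j.
have /matrixP/(_ i i) := SO_trmxr XSO.
rewrite !mxE eqxx mulr1n (bigD1 j) //= mxE => row_norm.
rewrite -(ler_pXn2r (n := 2)) ?nnegrE // -normrX (ger0_norm (sqr_ge0 _)) expr1n expr2.
by rewrite -row_norm lerDl sumr_ge0// => k _; rewrite mxE -expr2 sqr_ge0.
Qed.

Lemma ler_norm_mulSOl P A : in_SO P -> `|P *m A| <= n%:R * `|A|.
Proof.
move=> /SO_norm P1; apply: le_trans (ler_mx_normM _ _) _.
by rewrite ler_wpM2r// -[leRHS]mulr1 ler_wpM2l.
Qed.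

Lemma ler_norm_mulSOr P A : in_SO P -> `|A *m P| <= n%:R * `|A|.
Proof.
move=> /SO_norm P1; apply: le_trans (ler_mx_normM _ _) _.
by rewrite -[leRHS]mulr1 ler_wpM2l// mulr_ge0.
Qed.

Lemma ler_norm_mulSOlr P A Q : in_SO P -> in_SO Q ->
  `|P *m A *m Q| <= n%:R ^+ 2 * `|A|.
Proof.
move=> PSO QSO; apply: le_trans (ler_norm_mulSOr _ QSO) _.
by rewrite expr2 -mulrA ler_wpM2l// ler_norm_mulSOl.
Qed.

Lemma ler_norm_SO_conjB P Q A : in_SO P -> in_SO Q ->
  `|P *m A *m P^T - Q *m A *m Q^T| <= 2 * n%:R ^+ 2 * `|A| * `|P - Q|.
Proof.
move=> PSO QSO.
have -> : P *m A *m P^T - Q *m A *m Q^T = (P - Q) *m A *m P^T + Q *m A *m (P - Q)^T.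
  by rewrite [(P - Q)^T]raddfB /= mulmxBr !mulmxBl addrA subrK.
have -> : 2 * n%:R ^+ 2 * `|A| * `|P - Q| =
    n%:R * (n%:R * `|P - Q| * `|A|) + n%:R * (n%:R * `|A| * `|P - Q|) by ring.
rewrite (le_trans (ler_normD _ _))// lerD//.
  by rewrite (le_trans (ler_norm_mulSOr _ (SO_tr PSO)))// ler_wpM2l// ler_mx_normM.
rewrite -mulmxA (le_trans (ler_norm_mulSOl _ QSO))// ler_wpM2l//.
by rewrite (le_trans (ler_mx_normM _ _))// ler_wpM2l ?mulr_ge0// ler_mx_norm_tr.
Qed.

Lemma ler_norm_SO_subX P Q k : in_SO P -> in_SO Q ->
  `|P ^+ k - Q ^+ k| <= k%:R * (n%:R ^+ 2 * `|P - Q|).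
Proof.
move=> PSO QSO.
pose mixed i := P ^+ (k - i) *m Q ^+ i.
have -> : P ^+ k - Q ^+ k = \sum_(0 <= i < k) (mixed i - mixed i.+1).
  under eq_bigr do rewrite -opprB; rewrite sumrN telescope_sumr// opprB.
  by rewrite /mixed subn0 subnn !expr0 mulmx1 mul1mx.
apply: le_trans (ler_norm_sum _ _ _) _; rewrite big_mkord.
rewrite (@le_trans _ _ (\sum_(i < k) n%:R ^+ 2 * `|P - Q|))//; last first.
  by rewrite sumr_const card_ord mulr_natl.
apply: ler_sum => i _; have -> : mixed i - mixed i.+1 = P ^+ (k - i.+1) *m (P - Q) *m Q ^+ i.
  by rewrite /mixed mulmxBr mulmxBl !mulmxE -exprSr subnSK// -mulrA -exprS.
by apply: ler_norm_mulSOlr; exact: SO_exp.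
Qed.

Lemma closed_SO : closed (@in_SO R n : set 'M[R]_n).
Proof.
have -> : (@in_SO R n : set 'M[R]_n) =
  (fun X => X *m X^T) @^-1` [set 1%:M] `&` determinant @^-1` [set 1] by [].
have cvg_idmx X : id @ X --> (X : 'M[R]_n) by exact: cvg_id.
apply: closedI.
- apply: preimage_closed => [X _|].
    exact: cvg_mulmx (cvg_idmx X) (cvg_trmx (cvg_idmx X)).
  by apply: compact_closed; [exact: norm_hausdorff|exact: compact_set1].
- apply: preimage_closed => [X _|]; last exact: closed_eq.
  exact: cvg_determinant (cvg_idmx X).
Qed.

Lemma compact_SO : compact (@in_SO R n : set 'M[R]_n).
Proof. exact: bounded_closed_mx_compact SO_norm closed_SO. Qed.

End SpecialOrthogonal.

Section Rotations.
Variables (R : realType) (n : nat).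
Local Notation B := (@Bbasis R n).
Implicit Types (A C D X : 'M[R]_n) (i j k p q : 'I_n) (t u : R).

Lemma so_Bbasis i j : in_so (B i j).
Proof. by rewrite /in_so /Bbasis linearB /= !trmx_delta opprB. Qed.

Lemma BbasisC i j : B j i = - B i j.
Proof. by rewrite /Bbasis opprB. Qed.

Lemma Bbasis_sqr i j : i != j -> B i j *m B i j = - (delta_mx i i + delta_mx j j).
Proof.
move=> ij; rewrite /Bbasis mulmxBl !mulmxBr !mul_delta_mx_cond.
by rewrite !eqxx (negPf ij) eq_sym (negPf ij) !mulr0n !mulr1n sub0r subr0 opprD.
Qed.

Lemma Bbasis_cube i j : i != j -> B i j *m B i j *m B i j = - B i j.
Proof.
move=> ij; rewrite Bbasis_sqr // /Bbasis mulNmx mulmxDl !mulmxBr !mul_delta_mx_cond.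
by rewrite !eqxx (negPf ij) eq_sym (negPf ij) !mulr0n !mulr1n sub0r subr0.
Qed.

Lemma expmx_rodrigues A t : A *m A *m A = - A ->
  expmx (t *: A) = 1%:M + sin t *: A + (1 - cos t) *: (A *m A).
Proof.
move=> A3; pose F s : 'M[R]_n := 1%:M + sin s *: A + (1 - cos s) *: (A *m A).
have dF u : is_derive u 1 F (A *m F u).
  have dcos : is_derive u 1 (fun s => 1 - cos s) (sin u).
    apply: is_derive_eq (is_deriveB (is_derive_cst (1 : R) u 1) (is_derive_cos u)) _.
    by rewrite sub0r opprK.
  apply: is_derive_eq.
    apply: is_deriveD (is_deriveZl _ dcos).
    exact: is_deriveD (is_derive_cst _ _ _) (is_deriveZl _ (is_derive_sin u)).
  rewrite /F !mulmxDr mulmx1 -!scalemxAr mulmxA A3 add0r scalerN scalerBl scale1r.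
  by rewrite opprB [RHS]addrAC [A + _]addrCA subrr addr0.
rewrite -[LHS]mulmx1; have := linear_ode_unique dF t.
by rewrite {2}/F sin0 cos0 subrr !scale0r !addr0 => <-.
Qed.

Lemma expmx_conj_rotation A C D t :
  C *m A - A *m C = - D -> C *m D - D *m C = A ->
  expmx (t *: C) *m A *m expmx (t *: - C) = cos t *: A - sin t *: D.
Proof.
move=> CA CD; pose F s : 'M[R]_n := (cos s *: A - sin s *: D) *m expmx (s *: C).
have dF u : is_derive u 1 F (C *m F u).
  have dcos := is_deriveZl A (is_derive_cos u).
  have dsin := is_deriveZl D (is_derive_sin u).
  apply: is_derive_eq.
    exact: is_derive_mulmx (is_deriveB dcos dsin) (is_derive_expmx _ u).
  rewrite /F !mulmxA -mulmxDl; congr (_ *m _).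
  rewrite mulmxBr mulmxBl -!scalemxAl -!scalemxAr -[in RHS](subrK (A *m C) (C *m A)).
  rewrite CA -[in RHS](subrK (D *m C) (C *m D)) CD !scalerDr opprD scalerN scaleNr.
  by rewrite [RHS]addrACA [- _ - _]addrC.
have := linear_ode_unique dF t; rewrite {2}/F cos0 sin0 scale0r scale1r subr0.
rewrite scale0r expmx0 mulmx1 => <-; rewrite /F -mulmxA.
by rewrite scalerN expmxVr mulmx1.
Qed.

Lemma expmx_Bbasis_conj i j k t : i != j -> j != k -> i != k ->
  expmx (t *: B j k) *m B i j *m expmx (t *: - B j k) = cos t *: B i j - sin t *: B i k.
Proof.
move=> ij jk ik.
have [ji kj ki] : [/\ j != i, k != j & k != i] by rewrite ![_ == i]eq_sym [k == j]eq_sym.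
apply: expmx_conj_rotation; rewrite /Bbasis !mulmxBl !mulmxBr !mul_delta_mx_cond;
  rewrite !eqxx !(negPf ij, negPf jk, negPf ik, negPf ji, negPf kj, negPf ki);
  by rewrite !mulr0n !mulr1n !(subr0, sub0r, opprK, opprB, addr0, add0r) // addrC.
Qed.

Lemma mxtrace_delta p q X : \tr (delta_mx p q *m X) = X q p.
Proof.
rewrite -(mul_delta_mx (0 : 'I_1)) -mulmxA mxtrace_mulC -rowE -colE.
by rewrite trace_mx11 !mxE.
Qed.

Lemma mxtrace_Bbasis p q X : \tr (B p q *m X) = X q p - X p q.
Proof. by rewrite /Bbasis mulmxBl raddfB /= !mxtrace_delta. Qed.

End Rotations.

Lemma exists_gt0_mul_lt (F : realFieldType) (c e : F) : 0 <= c -> 0 < e ->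
  exists2 d, 0 < d & c * d < e.
Proof.
move=> c0 e0; have c1 : 0 < c + 1 by rewrite ltr_wpDl.
exists (e / (c + 1)); first exact: divr_gt0.
by rewrite mulrCA gtr_pMr // ltr_pdivrMr // mul1r ltrDl.
Qed.

Definition SO_semigroup (R : realType) (n : nat) (S : set 'M[R]_n) :=
  [/\ S 1%:M, forall X Y, S X -> S Y -> S (X *m Y) & S `<=` @in_SO R n].

Definition liealg (R : realType) (n : nat) (K : set 'M[R]_n) : set 'M[R]_n :=
  [set A | forall t : R, K (expmx (t *: A))].

Lemma SO_semigroup_closure (R : realType) (n : nat) (S : set 'M[R]_n) :
  SO_semigroup S -> SO_semigroup (closure S).
Proof.
move=> [S1 SM S_SO]; split; first exact: subset_closure.
  move=> X Y cSX cSY U UXY.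
  have fstX : fst @ (X, Y) --> X by exact: cvg_fst.
  have sndY : snd @ (X, Y) --> Y by exact: cvg_snd.
  have [[U1 U2] /= [U1X U2Y] U12] := cvg_mulmx fstX sndY UXY.
  have [X' [SX' U1X']] := cSX _ U1X; have [Y' [SY' U2Y']] := cSY _ U2Y.
  by exists (X' *m Y'); split; [exact: SM|exact: (U12 (X', Y'))].
rewrite (closure_id (@in_SO R n)).1; first exact: closureS.
exact: closed_SO.
Qed.

Section ClosedSemigroup.
Variables (R : realType) (n : nat) (K : set 'M[R]_n).
Hypotheses (closedK : closed K) (semiK : SO_semigroup K).
Implicit Types (A B P X Y : 'M[R]_n) (t : R).

Let K1 : K 1%:M. Proof. by case: semiK. Qed.
Let KM X Y : K X -> K Y -> K (X *m Y). Proof. by case: semiK => _ + _; apply. Qed.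
Let K_SO X : K X -> in_SO X. Proof. by case: semiK => _ _; apply. Qed.

Let K_approx X : (forall e, 0 < e -> exists2 Y, K Y & `|X - Y| < e) -> K X.
Proof. by move=> /closure_normP; rewrite -(closure_id K).1. Qed.

Lemma closed_semigroupX X k : K X -> K (X ^+ k).
Proof. by move=> KX; elim: k => // k IH; rewrite exprS; exact: KM. Qed.

(* Recurrence: two powers of [X] are close, so some positive power is close to
   the inverse. *)
Lemma closed_semigroup_tr X : K X -> K X^T.
Proof.
move=> KX; have XSO := K_SO KX; apply: K_approx => e e0.
have [d d0 nd] := exists_gt0_mul_lt (ler0n R (n * 2)) e0.
have [p [_ clp]] : @in_SO R n `&` cluster ((fun k => X ^+ k) @ \oo) !=set0.
  by apply: compact_SO; exists 0%N => // k _; exact: SO_exp.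
have near_p N : exists2 k, (N <= k)%N & `|p - X ^+ k| < d.
  have [|Y [[k Nk <-] pY]] := clp [set X ^+ k | k in [set k | (N <= k)%N]] _ _
    (nbhsx_ballx p d d0); first by exists N => // k Nk; exists k.
  by exists k; rewrite // -ball_normE in pY *.
have [k _ pk] := near_p 0%N; have [l kl pl] := near_p k.+1.
exists (X ^+ (l - k.+1)); first exact: closed_semigroupX.
have XVX m : X ^+ m *m X^T ^+ m = 1%:M.
  elim: m => [|m IH]; first by rewrite !expr0 mulmx1.
  by rewrite exprSr exprS -!mulmxE mulmxA -[_ *m X *m _]mulmxA SO_trmxr// mulmx1.
have -> : X^T - X ^+ (l - k.+1) = (X ^+ k - X ^+ l) *m X^T ^+ k.+1.
  rewrite mulmxBl -{2}(subnK kl) exprD -mulmxE -[_ *m _ *m X^T ^+ _]mulmxA XVX mulmx1.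
  by rewrite exprSr -mulmxE mulmxA XVX mul1mx.
apply: le_lt_trans (ler_norm_mulSOr _ (SO_exp _ (SO_tr XSO))) _.
apply: le_lt_trans nd; rewrite natrM -mulrA ler_wpM2l// -(subrKA p).
by rewrite (le_trans (ler_normD _ _))// mulr2n mulrDl mul1r lerD// ltW// distrC.
Qed.

(* Chernoff's formula: [F k^-1 ^+ k] tends to [expmx A]. *)
Lemma closed_semigroup_chernoff (F : R -> 'M[R]_n) A : in_so A ->
  (forall t, K (F t)) -> F 0 = 1%:M -> is_derive (0 : R) 1 F A -> K (expmx A).
Proof.
move=> soA KF F0 dF; apply: K_approx => e e0.
have [d d0 nd] := exists_gt0_mul_lt (sqr_ge0 (n%:R : R)) e0.
have dG : is_derive (0 : R) 1 (F - (fun t => expmx (t *: A))) 0.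
  apply: is_derive_eq (is_deriveB dF (is_derive_expmx A 0)) _.
  by rewrite scale0r expmx0 mulmx1 subrr.
have [k] : exists k : nat, `|F k.+1%:R^-1 - expmx (k.+1%:R^-1 *: A)| <= d * k.+1%:R^-1.
  have /nbhs_ballP[r r0 Gr] := is_derive_linear_approx dG d0.
  have [k kr] : exists k : nat, k.+1%:R^-1 < r.
    exists (Num.truncn r^-1); rewrite -[ltRHS]invrK ltf_pV2 ?posrE ?invr_gt0 //.
    by rewrite truncnS_gt.
  exists k; have := Gr k.+1%:R^-1.
  rewrite /ball /= sub0r normrN ger0_norm// => /(_ kr).
  by rewrite add0r !fctE F0 scale0r expmx0 subrr subr0 scaler0 subr0.
move=> FE; exists (F k.+1%:R^-1 ^+ k.+1); first exact: closed_semigroupX.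
have -> : expmx A = expmx (k.+1%:R^-1 *: A) ^+ k.+1.
  by rewrite expmxX scalerA divff ?scale1r// pnatr_eq0.
rewrite distrC; apply: le_lt_trans nd.
have SOE : in_SO (expmx (k.+1%:R^-1 *: A)) by apply: SO_expmx; exact: soZ.
apply: le_trans (ler_norm_SO_subX k.+1 (K_SO (KF _)) SOE) _.
by rewrite mulrCA ler_wpM2l ?sqr_ge0// mulrC -ler_pdivlMr.
Qed.

Lemma liealg_so A : liealg K A -> in_so A.
Proof.
move=> KA.
have d_tr := is_derive_trmx (is_derive_expmx A 0).
have d_inv := is_derive_expmx (- A) 0.
have tr_inv : (fun s : R => (expmx (s *: A))^T) = (fun s => expmx (s *: - A)).
  apply/funext => s; rewrite scalerN -[RHS]mul1mx -(SO_trmxl (K_SO (KA s))) -mulmxA.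
  by rewrite expmxVr mulmx1.
move: d_tr d_inv; rewrite tr_inv => -[_ D_tr] [_].
by rewrite D_tr !scale0r expmx0 !mulmx1.
Qed.

Lemma liealg_pos A : in_so A -> (forall t, 0 <= t -> K (expmx (t *: A))) -> liealg K A.
Proof.
move=> soA KA t; have [/KA//|t0] := leP 0 t.
have -> : t *: A = (- t *: A)^T by rewrite linearZ /= soA scaleNr scalerN opprK.
by rewrite expmx_tr; apply: closed_semigroup_tr; apply: KA; rewrite oppr_ge0 ltW.
Qed.

Lemma liealg0 : liealg K 0.
Proof. by move=> t; rewrite scaler0 expmx0. Qed.

Lemma liealgZ c A : liealg K A -> liealg K (c *: A).
Proof. by move=> KA t; rewrite scalerA. Qed.

Lemma liealgD A B : liealg K A -> liealg K B -> liealg K (A + B).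
Proof.
move=> KA KB t; apply: (@closed_semigroup_chernoff
    (fun s => expmx (s *: (t *: A)) *m expmx (s *: (t *: B)))).
- by apply: soZ; apply: soD; exact: liealg_so.
- by move=> s; rewrite !scalerA; exact: KM.
- by rewrite !scale0r expmx0 mulmx1.
- apply: is_derive_eq.
    exact: is_derive_mulmx (is_derive_expmx _ _) (is_derive_expmx _ _).
  by rewrite !scale0r expmx0 !mulmx1 mul1mx scalerDr.
Qed.

Lemma liealgN A : liealg K A -> liealg K (- A).
Proof. by move=> KA; rewrite -scaleN1r; exact: liealgZ. Qed.

Lemma liealgB A B : liealg K A -> liealg K B -> liealg K (A - B).
Proof. by move=> KA KB; exact: liealgD KA (liealgN KB). Qed.

Lemma liealg_conj P A : K P -> liealg K A -> liealg K (P *m A *m P^T).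
Proof.
move=> KP KA t; have PSO := K_SO KP.
rewrite scalemxAl scalemxAr expmx_conj; [|exact: SO_trmxl|exact: SO_trmxr].
by apply: KM; [exact: KM|exact: closed_semigroup_tr].
Qed.

End ClosedSemigroup.

Lemma crossing_all_cutsE (T : eqType) (i i1 i2 j j1 j2 p q : T) :
  let crosses k l := ((p == k) || (p == l)) (+) ((q == k) || (q == l)) in
  uniq [:: i; i1; i2; j; j1; j2] ->
  [&& crosses i i1, crosses i i2, crosses j j1 & crosses j j2] =
  ((p == i) && (q == j)) || ((p == j) && (q == i)).
Proof.
set L := [:: i; i1; i2; j; j1; j2] => /= uL.
have nthE (k : nat) x : (k < 6)%N -> (x == nth i L k) = (index x L == k).
  move=> k6; apply/eqP/eqP => [->|xk]; first exact: index_uniq.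
  by rewrite -xk nth_index // -index_mem xk.
have Ei x : (x == i) = (index x L == 0%N) := nthE 0%N x isT.
have Ei1 x : (x == i1) = (index x L == 1%N) := nthE 1%N x isT.
have Ei2 x : (x == i2) = (index x L == 2%N) := nthE 2%N x isT.
have Ej x : (x == j) = (index x L == 3%N) := nthE 3%N x isT.
have Ej1 x : (x == j1) = (index x L == 4%N) := nthE 4%N x isT.
have Ej2 x : (x == j2) = (index x L == 5%N) := nthE 5%N x isT.
rewrite !Ei !Ei1 !Ei2 !Ej !Ej1 !Ej2; move: (index p L) (index q L) => a b.
by case: a => [|[|[|[|[|[|a]]]]]]; case: b => [|[|[|[|[|[|b]]]]]].
Qed.

Section Cuts.
Variables (R : realType) (n : nat).
Local Notation B := (@Bbasis R n).
Implicit Types (A : 'M[R]_n) (D : {set 'I_n}) (i j k l p q : 'I_n).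

Definition cut_mx D A : 'M[R]_n :=
  \matrix_(p, q) (A p q *+ ((p \in D) (+) (q \in D))).

Lemma expmx_pi_Bbasis k l : k != l ->
  expmx (pi *: B k l) = diag_mx (\row_p (-1) ^+ (p \in [set k; l]%SET)).
Proof.
move=> kl; rewrite (expmx_rodrigues _ (Bbasis_cube _ kl)) Bbasis_sqr //.
rewrite sinpi cospi scale0r addr0 opprK; apply/matrixP => p q; rewrite !mxE !inE.
have [<-|pq] := eqVneq p q; last first.
  have off_diag x : (p == x) && (q == x) = false.
    by apply/negP => /andP[/eqP px /eqP qx]; rewrite px qx eqxx in pq.
  by rewrite !off_diag mulr0n /=; ring.
rewrite !andbb !mulr1n; case: (eqVneq p k) => [->|_]; first by rewrite (negPf kl) /=; ring.
by case: (p == l) => /=; ring.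
Qed.

Lemma cut_mxE k l A : k != l ->
  cut_mx [set k; l]%SET A =
  2^-1 *: (A - expmx (pi *: B k l) *m A *m (expmx (pi *: B k l))^T).
Proof.
move=> kl; rewrite expmx_pi_Bbasis// tr_diag_mx mul_diag_mx mul_mx_diag.
apply/matrixP => p q; rewrite !mxE.
by case: (p \in _); case: (q \in _); rewrite /= ?expr0 ?expr1; field.
Qed.

Lemma cut_mx_isolate A i i1 i2 j j1 j2 :
  uniq [:: i; i1; i2; j; j1; j2] -> in_so A ->
  cut_mx [set j; j2]%SET (cut_mx [set j; j1]%SET
    (cut_mx [set i; i2]%SET (cut_mx [set i; i1]%SET A))) = A i j *: B i j.
Proof.
move=> uL /matrixP soA; apply/matrixP => p q; rewrite !mxE -!mulrnA !mulnb !inE.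
rewrite (crossing_all_cutsE p q uL).
have ij : (i == j) = false.
  by move: uL => /= /andP[]; rewrite !inE !negb_or => /and5P[_ _ /negPf].
have [/andP[/eqP-> /eqP->]|_] := boolP ((p == i) && (q == j)).
  by rewrite ij subr0 mulr1.
have [/andP[/eqP-> /eqP->]|_] := boolP ((p == j) && (q == i)).
  by have := soA i j; rewrite !mxE sub0r mulrN mulr1 => ->.
by rewrite subrr mulr0.
Qed.

End Cuts.

Lemma components_ge3_triple n (e : rel 'I_n) i : components_ge3 e ->
  exists i1 i2, [/\ connect e i i1, connect e i i2 & uniq [:: i; i1; i2]].
Proof.
move=> /(_ i) comp3.
have /card_gt1P[i1 [i2 []]] : (1 < #|[predD1 connect e i & i]|)%N.
  move: comp3; rewrite (@eq_card _ _ (connect e i)) => [|j].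
    by rewrite (cardD1 i) inE connect0 add1n ltnS.
  by apply/idP/idP => [/set_mem|?]; [exact|exact/mem_set].
rewrite !inE => /andP[i1i ii1] /andP[i2i ii2] i12.
by exists i1, i2; split=> //=; rewrite !inE negb_or ![i == _]eq_sym i1i i2i i12.
Qed.

Section LiealgGraph.
Variables (R : realType) (n : nat) (K : set 'M[R]_n).
Hypotheses (closedK : closed K) (semiK : SO_semigroup K).
Local Notation B := (@Bbasis R n).
Implicit Types (A : 'M[R]_n) (i j k : 'I_n).

Lemma liealg_cut i j A : i != j ->
  liealg K (B i j) -> liealg K A -> liealg K (cut_mx [set i; j]%SET A).
Proof.
move=> ij Kij KA; rewrite cut_mxE//; apply: liealgZ.
apply: (liealgB closedK semiK KA); exact: (liealg_conj closedK semiK (Kij pi) KA).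
Qed.

Lemma liealg_isolate A i i1 i2 j j1 j2 : uniq [:: i; i1; i2; j; j1; j2] ->
  liealg K A -> liealg K (B i i1) -> liealg K (B i i2) ->
  liealg K (B j j1) -> liealg K (B j j2) ->
  A i j != 0 -> liealg K (B i j).
Proof.
move=> u6 KA Kii1 Kii2 Kjj1 Kjj2 Aij.
have [ii1 ii2 jj1 jj2] : [/\ i != i1, i != i2, j != j1 & j != j2].
  move: u6; rewrite /= !inE !negb_or => /and5P[/and5P[-> -> _ _ _] _ _].
  by move=> /andP[-> ->].
rewrite -[B i j]scale1r -(mulVf Aij) -scalerA; apply: liealgZ.
rewrite -(cut_mx_isolate u6 (liealg_so semiK KA)).
apply: (liealg_cut jj2 Kjj2); apply: (liealg_cut jj1 Kjj1).
exact: liealg_cut ii2 Kii2 (liealg_cut ii1 Kii1 KA).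
Qed.

Lemma liealg_Bbasis_refl i : liealg K (B i i).
Proof. by rewrite /Bbasis subrr; exact: liealg0. Qed.

Lemma liealg_Bbasis_sym i j : liealg K (B i j) -> liealg K (B j i).
Proof. by move=> Kij; rewrite BbasisC; exact: liealgN. Qed.

Lemma liealg_Bbasis_trans i j k :
  liealg K (B i j) -> liealg K (B j k) -> liealg K (B i k).
Proof.
move=> Kij Kjk.
have [->//|ij] := eqVneq i j; have [<-//|jk] := eqVneq j k.
have [<-|ik] := eqVneq i k; first exact: liealg_Bbasis_refl.
have := expmx_Bbasis_conj (- (pi / 2) : R) ij jk ik.
rewrite cosN sinN cos_pihalf sin_pihalf scale0r scaleN1r opprK add0r => <-.
have <- : (expmx (- (pi / 2) *: B j k))^T = expmx (- (pi / 2) *: - B j k).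
  by rewrite -expmx_tr linearZ /= so_Bbasis.
by apply: liealg_conj => //; exact: Kjk.
Qed.

Lemma liealg_Bbasis_connect (e : rel 'I_n) :
  (forall i j, e i j -> liealg K (B i j)) ->
  forall i j, connect e i j -> liealg K (B i j).
Proof.
move=> Ke i j /connectP[p]; elim: p i => [|k p IH] i /=.
  by move=> _ ->; exact: liealg_Bbasis_refl.
by move=> /andP[eik kp] pj; exact: liealg_Bbasis_trans (Ke _ _ eik) (IH k kp pj).
Qed.

Lemma liealg_Bbasis_all (e : rel 'I_n) A : components_ge3 e ->
  graph_connected (union_rel (fun i j => A i j != 0) e) ->
  liealg K A -> (forall i j, e i j -> liealg K (B i j)) ->
  forall i j, liealg K (B i j).
Proof.
move=> comp3 conn KA Ke i j; apply: liealg_Bbasis_connect (conn i j).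
move=> {}i {}j /orP[Aij|]; last exact: Ke.
have Kconn := liealg_Bbasis_connect Ke.
have [i1 [i2 [/Kconn Kii1 /Kconn Kii2 ui]]] := components_ge3_triple i comp3.
have [j1 [j2 [/Kconn Kjj1 /Kconn Kjj2 uj]]] := components_ge3_triple j comp3.
have [//|nKij] := pselect (liealg K (B i j)).
have disjoint_triples k : liealg K (B i k) -> ~ liealg K (B j k).
  move=> Kik Kjk; apply: nKij; apply: liealg_Bbasis_trans Kik _.
  exact: liealg_Bbasis_sym.
apply: (liealg_isolate _ KA Kii1 Kii2 Kjj1 Kjj2 Aij).
rewrite (cat_uniq [:: i; i1; i2] [:: j; j1; j2]) ui uj andbT andTb.
apply/hasPn => k kj; apply/negP => ki; apply: (disjoint_triples k).
  move: ki; rewrite !inE => /or3P[]/eqP->;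
    [exact: liealg_Bbasis_refl|exact: Kii1|exact: Kii2].
move: kj; rewrite !inE => /or3P[]/eqP->;
  [exact: liealg_Bbasis_refl|exact: Kjj1|exact: Kjj2].
Qed.

End LiealgGraph.

Lemma sin_cos_comb_le0 (R : realType) (a b : R) :
  (forall t, a * sin t + b * (1 - cos t) <= 0) ->
  a = 0 /\ b <= 0.
Proof.
move=> f_le0; split; last by have := f_le0 pi; rewrite sinpi cospi; lra.
pose f t := a * sin t + b * (1 - cos t).
have df (t : R) : is_derive t 1 f (a * cos t + b * sin t).
  have dcos := is_deriveB (is_derive_cst (1 : R) t 1) (is_derive_cos t).
  apply: is_derive_eq (is_deriveD (is_deriveZ a (is_derive_sin t)) (is_deriveZ b dcos)) _.
  by rewrite sub0r opprK.
have [] : is_derive (0 : R) 1 f 0.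
  apply: (@derive1_at_max _ f (- 1) 1).
  - by rewrite -subr_ge0 opprK addr_ge0.
  - by move=> t _; case: (df t).
  - by rewrite in_itv /= ltrN10 ltr01.
  - by move=> t _; rewrite [leRHS]/f sin0 cos0 subrr !mulr0 addr0; exact: f_le0.
by move=> _; case: (df 0) => _ ->; rewrite cos0 sin0 mulr1 mulr0 addr0.
Qed.

Section WeightedTrace.
Variables (R : realType) (n : nat).
Local Notation B := (@Bbasis R n).
Implicit Types (M Z : 'M[R]_n) (i j : 'I_n) (w : 'I_n -> R).

Lemma rotation_max_mxtrace M i j : i != j ->
  (forall t, \tr (expmx (t *: B i j) *m M) <= \tr M) ->
  M j i = M i j /\ 0 <= M i i + M j j.
Proof.
move=> ij tr_max.
have [] := @sin_cos_comb_le0 R (M j i - M i j) (- (M i i + M j j)).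
  move=> t; have := tr_max t.
  rewrite (expmx_rodrigues _ (Bbasis_cube _ ij)) Bbasis_sqr // !mulmxDl mul1mx -!scalemxAl.
  rewrite !mxtraceD !mxtraceZ mxtrace_Bbasis mulNmx raddfN /= mulmxDl mxtraceD.
  by rewrite !mxtrace_delta; lra.
by move=> /eqP; rewrite subr_eq0 oppr_le0 => /eqP.
Qed.

(* [Z D] is symmetric, hence [Z] commutes with [D ^ 2]. *)
Lemma orthogonal_sym_mul_diag w Z : in_SO Z -> (forall i, 0 < w i) -> injective w ->
  (Z *m diag_mx (\row_i w i))^T = Z *m diag_mx (\row_i w i) -> is_diag_mx Z.
Proof.
set D := diag_mx _ => ZSO w_gt0 w_inj ZD_sym.
have DZ_sym : D *m Z^T = Z *m D by rewrite -ZD_sym trmx_mul tr_diag_mx.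
have DDE : D *m D = Z *m D *m (D *m Z^T).
  by rewrite DZ_sym -{1}DZ_sym -mulmxA [Z^T *m _]mulmxA SO_trmxl// mul1mx.
have comm_sqr : D *m (D *m Z) = Z *m D *m D.
  by rewrite mulmxA DDE -!mulmxA SO_trmxl// mulmx1.
apply/is_diag_mxP => i j ij.
have /matrixP/(_ i j) := comm_sqr.
rewrite !mul_diag_mx !mul_mx_diag !mxE => comm_ij.
have /eqP : (w i ^+ 2 - w j ^+ 2) * Z i j = 0 by rewrite !expr2; lra.
by rewrite mulf_eq0 subr_eq0 eqrXn2 ?ltW// inj_eq// -val_eqE (negPf ij) => /eqP.
Qed.

Lemma diag_SO_id w Z : in_SO Z -> is_diag_mx Z -> (forall i, 0 < w i) ->
  (forall i j, i != j -> 0 <= Z i i * w i + Z j j * w j) -> Z = 1%:M.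
Proof.
move=> ZSO /diag_mxP[d Zd] w_gt0; move: ZSO; rewrite {}Zd => -[DD1 detD] pair_ge0.
have d_sqr i : d 0 i ^+ 2 = 1.
  have /matrixP/(_ i i) := DD1.
  by rewrite tr_diag_mx mul_diag_mx !mxE eqxx !mulr1n expr2.
suff d1 i : d 0 i = 1 by apply/matrixP => i j; rewrite !mxE d1.
have /eqP := d_sqr i; rewrite sqrf_eq1 => /predU1P[//|/eqP di].
have d_others j : j != i -> d 0 j = 1.
  move=> ji; have := pair_ge0 i j; rewrite eq_sym => /(_ ji).
  rewrite !mxE !eqxx !mulr1n di => wij; have := w_gt0 i.
  have /eqP := d_sqr j; rewrite sqrf_eq1 => /predU1P[//|/eqP dj].
  by have := w_gt0 j; move: wij; rewrite dj; lra.
move: detD; rewrite det_diag (bigD1 i) //= big1 ?mulr1 => [|j /d_others//].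
by rewrite di; lra.
Qed.

Lemma closed_semigroup_full (K : set 'M[R]_n) : closed K -> SO_semigroup K ->
  (forall i j, liealg K (B i j)) -> forall X, in_SO X -> K X.
Proof.
move=> closedK [K1 KM K_SO] KB X XSO.
pose w i : R := i.+1%:R.
pose C := X^T *m diag_mx (\row_i w i).
have [Y] : exists2 Y, Y \in K & forall Z, Z \in K -> \tr (Z *m C) <= \tr (Y *m C).
  apply: compact_EVT_max.
  - by exists 1%:M.
  - exact: subclosed_compact closedK (@compact_SO R n) K_SO.
  - apply: continuous_subspaceT => Z.
    have idZ : id @ Z --> Z by exact: cvg_id.
    exact: cvg_mxtrace (cvg_mulmx idZ (cvg_cst C)).
rewrite inE => KY Y_max.
pose Z := Y *m X^T; pose M := Z *m diag_mx (\row_i w i).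
have ZSO : in_SO Z by apply: SO_mul; [exact: K_SO|exact: SO_tr].
have M_crit i j : i != j -> M j i = M i j /\ 0 <= M i i + M j j.
  move=> ij; apply: rotation_max_mxtrace => // t.
  rewrite /M /Z -!mulmxA mulmxA; apply: Y_max; rewrite inE.
  by apply: KM => //; exact: KB.
have w_gt0 i : 0 < w i by rewrite ltr0n.
have w_inj : injective w.
  by move=> i j /eqP; rewrite eqr_nat => /eqP[/val_inj].
have M_sym : M^T = M.
  apply/matrixP => i j; rewrite mxE.
  by have [->//|/M_crit[]] := eqVneq i j.
have Z_diag : is_diag_mx Z := orthogonal_sym_mul_diag ZSO w_gt0 w_inj M_sym.
have Z1 : Z = 1%:M.
  apply: (diag_SO_id ZSO Z_diag w_gt0) => i j /M_crit[_].
  by rewrite /M mul_mx_diag ![(\matrix_(_, _) _) _ _]mxE !mxE.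
by rewrite -[X]mul1mx -Z1 -mulmxA SO_trmxl// mulmx1.
Qed.

End WeightedTrace.

Section SignedConjugates.
Variables (R : realType) (n : nat).
Local Notation B := (@Bbasis R n).
Implicit Types (a b p q : 'I_n) (s : {perm 'I_n}).

Lemma perm_mx_conj_delta s p q :
  perm_mx s *m delta_mx (s p) (s q) *m (perm_mx s)^T = delta_mx p q :> 'M[R]_n.
Proof.
rewrite tr_perm_mx -row_permE -col_permE; apply/matrixP => x y; rewrite !mxE.
by rewrite !(inj_eq perm_inj).
Qed.

Lemma perm_mx_conj_Bbasis s p q :
  perm_mx s *m B (s p) (s q) *m (perm_mx s)^T = B p q.
Proof. by rewrite /Bbasis mulmxBr mulmxBl !perm_mx_conj_delta. Qed.

Lemma perm_mx_SO s : ~~ s -> in_SO (perm_mx s : 'M[R]_n).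
Proof.
move=> s_even; split; last by rewrite det_perm (negPf s_even).
by rewrite tr_perm_mx -perm_mxM mulgV perm_mx1.
Qed.

Lemma perm_mapping2 a b p q : a != b -> p != q ->
  exists s : {perm 'I_n}, s p = a /\ s q = b.
Proof.
move=> ab pq; pose q' := tperm p a q; exists (tperm p a * tperm q' b)%g.
rewrite !permM tpermL tpermL; split=> //; rewrite tpermD// 1?eq_sym//.
by rewrite -[X in X != _](tpermL p a) (inj_eq perm_inj).
Qed.

Lemma Bbasis_signed_conj a b p q : a != b -> p != q ->
  exists (eps : bool) Q, in_SO Q /\ B p q = Q *m ((-1) ^+ eps *: B a b) *m Q^T.
Proof.
move=> ab pq; have [s [sp sq]] := perm_mapping2 ab pq; exists (odd_perm s).
have [s_odd|s_even] := boolP (odd_perm s); last first.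
  exists (perm_mx s); rewrite scale1r -sp -sq perm_mx_conj_Bbasis.
  by split=> //; exact: perm_mx_SO.
exists (perm_mx (tperm p q * s)); split.
  by apply: perm_mx_SO; rewrite odd_permM odd_tperm pq s_odd.
have -> : B a b = B ((tperm p q * s)%g q) ((tperm p q * s)%g p).
  by rewrite !permM tpermR tpermL sp sq.
by rewrite expr1 scaleN1r mulmxN mulNmx perm_mx_conj_Bbasis -BbasisC.
Qed.

End SignedConjugates.

Section StrictApproximation.
Variables (R : realType) (U : normedModType R) (n : nat).
Implicit Types (f g L : U -> 'M[R]_n) (x y : U) (d e C : R).

(* Required for every [d > 0], with [L] linear and bounded, this is strict differentiability
   of [f] at [0]. *)
Definition strict_approx d L f := exists2 r, 0 < r & forall x y,
  `|x| <= r -> `|y| <= r -> `|f x - f y - L (x - y)| <= d * `|x - y|.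

Lemma strict_approx_lipschitz d L f C : strict_approx d L f ->
  (forall x, `|L x| <= C * `|x|) ->
  exists2 r, 0 < r & forall x y, `|x| <= r -> `|y| <= r ->
    `|f x - f y| <= (C + d) * `|x - y|.
Proof.
move=> [r r0 fL] LC; exists r => // x y xr yr.
rewrite -(subrK (L (x - y)) (f x - f y)) addrC mulrDl.
by rewrite (le_trans (ler_normD _ _))// lerD// fL.
Qed.

Lemma strict_approx_perturb d e L L' f : strict_approx d L f ->
  (forall x, `|L x - L' x| <= e * `|x|) -> strict_approx (d + e) L' f.
Proof.
move=> [r r0 fL] LL'; exists r => // x y xr yr.
by rewrite -(subrKA (L (x - y))) mulrDl (le_trans (ler_normD _ _))// lerD// fL.
Qed.

Lemma strict_approxM d1 d2 e L1 L2 f g C1 C2 : 0 < e -> 0 <= d1 -> 0 <= d2 ->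
  0 <= C1 -> 0 <= C2 ->
  (forall x, `|L1 x| <= C1 * `|x|) -> (forall x, `|L2 x| <= C2 * `|x|) ->
  f 0 = 1%:M -> g 0 = 1%:M -> strict_approx d1 L1 f -> strict_approx d2 L2 g ->
  strict_approx (d1 + d2 + e) (fun x => L1 x + L2 x) (fun x => f x *m g x).
Proof.
move=> e0 d10 d20 C10 C20 L1C L2C f0 g0 fL1 gL2.
have [rf rf0 f_lip] := strict_approx_lipschitz fL1 L1C.
have [rg rg0 g_lip] := strict_approx_lipschitz gL2 L2C.
case: fL1 => r1 r10 fL1; case: gL2 => r2 r20 gL2.
set K1 := C1 + d1 in f_lip; set K2 := C2 + d2 in g_lip.
have K10 : 0 <= K1 by exact: addr_ge0.
have K20 : 0 <= K2 by exact: addr_ge0.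
have [r3 r30 r3e] : exists2 r, 0 < r & 2 * n%:R * K1 * K2 * r < e.
  by apply: exists_gt0_mul_lt => //; rewrite !mulr_ge0.
exists (Num.min (Num.min rf rg) (Num.min (Num.min r1 r2) r3)) => [|x y].
  by rewrite !lt_min rf0 rg0 r10 r20.
rewrite !le_min => /andP[/andP[xf xg] /andP[/andP[x1 x2] x3]].
move=> /andP[/andP[yf yg] /andP[/andP[y1 y2] y3]].
have -> : f x *m g x - f y *m g y - (L1 (x - y) + L2 (x - y)) =
    (f x - f y - L1 (x - y)) + (g x - g y - L2 (x - y)) +
    ((f x - f y) *m (g x - g 0) + (f y - f 0) *m (g x - g y)).
  rewrite f0 g0 !mulmxBr !mulmxBl !mulmx1 !mul1mx.
  by apply/matrixP => i j; rewrite !mxE; ring.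
rewrite !mulrDl (le_trans (ler_normD _ _))// lerD//.
  by rewrite (le_trans (ler_normD _ _))// lerD ?fL1 ?gL2.
rewrite (le_trans (ler_normD _ _))//.
have half : n%:R * (K1 * `|x - y|) * (K2 * r3) <= (e / 2) * `|x - y|.
  have -> : n%:R * (K1 * `|x - y|) * (K2 * r3) =
    (2 * n%:R * K1 * K2 * r3) / 2 * `|x - y| by field.
  by rewrite ler_wpM2r// ler_wpM2r ?invr_ge0// ltW.
rewrite [e]splitr mulrDl lerD// (le_trans (ler_mx_normM _ _))// (le_trans _ half)//.
  rewrite ler_pM ?mulr_ge0// ?ler_wpM2l// ?f_lip//.
  by rewrite (le_trans (g_lip _ _ _ _)) ?normr0 ?subr0 ?ler_wpM2l// ltW.
have -> : n%:R * (K1 * `|x - y|) * (K2 * r3) = n%:R * (K1 * r3) * (K2 * `|x - y|) by ring.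
rewrite ler_pM ?mulr_ge0// ?ler_wpM2l// ?g_lip//.
by rewrite (le_trans (f_lip _ _ _ _)) ?normr0 ?subr0 ?ler_wpM2l// ltW.
Qed.

End StrictApproximation.

Lemma strict_approx_coord (R : realType) m k n (d : R) (L f : R -> 'M[R]_n)
    (p : 'I_m) (q : 'I_k) : 0 <= d -> strict_approx d L f ->
  strict_approx d (fun M : 'M[R]_(m, k) => L (M p q)) (fun M => f (M p q)).
Proof.
move=> d0 [r r0 fL]; exists r => // M N Mr Nr.
have -> : (M - N) p q = M p q - N p q by rewrite !mxE.
apply: le_trans (fL _ _ _ _) _; try exact: le_trans (ler_coord_mx_norm _ _ _) _.
by rewrite ler_wpM2l//; have := ler_coord_mx_norm (M - N) p q; rewrite !mxE.
Qed.

Lemma strict_approx_expmx (R : realType) (n : nat) (V : 'M[R]_n) (e : R) :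
  0 < e -> strict_approx e (fun t : R => t *: V) (fun t => expmx (t *: V)).
Proof.
move=> e0; have e20 : 0 < e / 2 by rewrite divr_gt0.
have [d1 d10 d1e] := exists_gt0_mul_lt (mulr_ge0 (ler0n R n) (ler0n R 2)) e20.
have [d2 d20 d2e] := exists_gt0_mul_lt (mulr_ge0 (ler0n R n) (normr_ge0 V)) e20.
have /nbhs_ballP[r1 r10 E_linear] := is_derive_linear_approx (is_derive_expmx V 0) d10.
have min_gt0 : 0 < Num.min d2 1 by rewrite lt_min d20 ltr01.
have /cvgrPdist_lt/(_ _ min_gt0)/nbhs_ballP[r2 r20 E_near1] :=
  @expmx_continuous R n V (0 : R).
set r := Num.min r1 r2; have r_gt0 : 0 < r by rewrite lt_min r10.
have [rr1 rr2] : r <= r1 /\ r <= r2 by rewrite !ge_min !lexx orbT.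
exists (r / 3) => [|x y xr yr]; first by rewrite divr_gt0.
set h := x - y.
have hr1 : `|h| < r1 by have := ler_normB x y; rewrite -/h; lra.
have yr2 : `|y| < r2 by lra.
have -> : expmx (x *: V) - expmx (y *: V) - h *: V =
    expmx (y *: V) *m (expmx (h *: V) - 1%:M - h *: V) +
    (expmx (y *: V) - 1%:M) *m (h *: V).
  have -> : expmx (x *: V) = expmx (y *: V) *m expmx (h *: V).
    by rewrite -expmxDl addrC subrK.
  by rewrite !mulmxBr mulmxBl mulmx1 mul1mx addrA subrK.
have /E_near1 : ball 0 r2 y by rewrite /ball /= sub0r normrN.
rewrite scale0r expmx0 distrC lt_min => /andP[/ltW Ey1 /ltW Ey2].
have Ey : `|expmx (y *: V)| <= 2.
  rewrite -(subrK 1%:M (expmx _)) (le_trans (ler_normD _ _))// [2]mulr2n lerD//.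
  exact: ler_mx_norm1.
have /E_linear : ball 0 r1 h by rewrite /ball /= sub0r normrN.
rewrite add0r !scale0r expmx0 mulmx1 => Eh.
rewrite (le_trans (ler_normD _ _))// [e in leRHS]splitr mulrDl lerD//.
  rewrite (le_trans (ler_mx_normM _ _))//.
  rewrite (@le_trans _ _ (n%:R * 2 * (d1 * `|h|)))//.
    by rewrite ler_pM ?mulr_ge0// ler_wpM2l.
  by rewrite mulrA ler_wpM2r// ltW.
rewrite (le_trans (ler_mx_normM _ _))// normrZ.
rewrite (@le_trans _ _ (n%:R * d2 * (`|h| * `|V|)))//.
  by rewrite ler_wpM2r ?mulr_ge0// ler_wpM2l.
have -> : n%:R * d2 * (`|h| * `|V|) = n%:R * `|V| * d2 * `|h| by ring.
by rewrite ler_wpM2r// ltW.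
Qed.

Section BbasisCombination.
Variables (R : realType) (n : nat).
Local Notation B := (@Bbasis R n).
Implicit Types (L : seq ('I_n * 'I_n)) (M : 'M[R]_n).

Definition Bbasis_comb L M : 'M[R]_n :=
  \sum_(pq <- L) M pq.1 pq.2 *: B pq.1 pq.2.

Lemma Bbasis_comb_bounded L : exists2 C, 0 <= C & forall M, `|Bbasis_comb L M| <= C * `|M|.
Proof.
exists (\sum_(pq <- L) `|B pq.1 pq.2|) => [|M]; first exact: sumr_ge0.
rewrite mulr_suml (le_trans (ler_norm_sum _ _ _))//; apply: ler_sum => pq _.
by rewrite normrZ mulrC ler_wpM2l// ler_coord_mx_norm.
Qed.

End BbasisCombination.

Section Chart.
Variables (R : realType) (n : nat) (S : set 'M[R]_n).
Hypotheses (semiS : SO_semigroup S) (denseS : @in_SO R n `<=` closure S).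
Variables (B0 : 'M[R]_n) (a b : 'I_n).
Hypotheses (soB0 : in_so B0) (ab : a != b).
Local Notation B := (@Bbasis R n).
Hypothesis S_expmx : forall u t : R, 0 <= t -> S (expmx (t *: (B0 + u *: B a b))).
Implicit Types (P M : 'M[R]_n) (p q : 'I_n).

(* The control part of [W = +- B a b + v *: B0] dominates for small [v], and conjugating by a
   suitable element of the dense set [S] turns it into [B p q]. *)
Lemma approx_Bbasis_direction P p q e : in_SO P -> p != q -> 0 < e ->
  exists g W, [/\ S g, in_so W, forall t, 0 <= t -> S (expmx (t *: W)) &
    `|P *m g *m W *m (P *m g)^T - B p q| <= e].
Proof.
move=> PSO pq e0; have e20 : 0 < e / 2 by rewrite divr_gt0.
have [eps [Q [QSO BQ]]] := @Bbasis_signed_conj R n _ _ _ _ ab pq.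
set C : 'M[R]_n := (-1) ^+ eps *: B a b in BQ.
have [v v0 ve] := exists_gt0_mul_lt (mulr_ge0 (sqr_ge0 (n%:R : R)) (normr_ge0 B0)) e20.
have [d d0 de] : exists2 d : R, 0 < d & 2 * n%:R ^+ 2 * `|C| * n%:R * d < e / 2.
  by apply: exists_gt0_mul_lt => //; rewrite !mulr_ge0.
have /closure_normP/(_ d d0)[g Sg gd] := denseS (SO_mul (SO_tr PSO) QSO).
have gSO : in_SO g by case: semiS => _ _; exact.
exists g, (C + v *: B0); split=> //.
- by apply: soD; apply: soZ => //; exact: so_Bbasis.
- move=> t t0.
  have -> : t *: (C + v *: B0) = (t * v) *: (B0 + (v^-1 * (-1) ^+ eps) *: B a b).
    rewrite -scalerA; congr (_ *: _); rewrite scalerDr scalerA mulVKf ?gt_eqF//.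
    by rewrite addrC.
  by apply: S_expmx; rewrite mulr_ge0// ltW.
have PgSO : in_SO (P *m g) by exact: SO_mul.
rewrite BQ mulmxDr mulmxDl addrAC [e]splitr (le_trans (ler_normD _ _))// lerD//.
  rewrite (le_trans (ler_norm_SO_conjB _ PgSO QSO))//.
  rewrite -[Q in _ - Q]mul1mx -(SO_trmxr PSO) -mulmxA -mulmxBr.
  apply: le_trans (ltW de); rewrite -[leRHS]mulrA ler_wpM2l ?mulr_ge0//.
  by rewrite (le_trans (ler_norm_mulSOl _ PSO))// ler_wpM2l// distrC ltW.
rewrite (le_trans (ler_norm_mulSOlr _ PgSO (SO_tr PgSO)))// normrZ gtr0_norm//.
by rewrite mulrCA mulrC ltW.
Qed.

Lemma chart_exists (L : seq ('I_n * 'I_n)) (d : R) :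
  0 < d -> all (fun pq => pq.1 != pq.2) L ->
  exists (A : 'M[R]_n -> 'M[R]_n) P, [/\ in_SO P, A 0 = 1%:M, strict_approx d (Bbasis_comb L) A &
    exists2 r, 0 < r & forall M, `|M| <= r -> S (A M *m P)].
Proof.
have [S1 SM S_SO] := semiS.
move=> + L_neq; elim: L L_neq d => [_|[p q] L IH /= /andP[pq /IH{}IH]] d d0.
  exists (fun=> 1%:M), 1%:M; split=> //; first exact: SO1.
    exists 1 => // x y _ _.
    by rewrite subrr sub0r normrN /Bbasis_comb big_nil normr0 mulr_ge0// ltW.
  by exists 1 => // M _; rewrite mulmx1.
have d40 : 0 < d / 4 by rewrite divr_gt0.
have [A [P [PSO A0 A_approx [r r0 S_AP]]]] := IH _ d40.
have [g [W [Sg soW S_expW W_approx]]] := approx_Bbasis_direction PSO pq d40.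
set X := P *m g in W_approx; pose V := X *m W *m X^T.
have XSO : in_SO X by apply: SO_mul => //; exact: S_SO.
exists (fun M => A M *m expmx (M p q *: V)), (X *m expmx W); split.
- by apply: SO_mul => //; exact: SO_expmx.
- by rewrite A0 mxE scale0r expmx0 mulmx1.
- have [C C0 L_bounded] := Bbasis_comb_bounded R L.
  have E_approx := strict_approx_coord p q (ltW d40) (strict_approx_expmx V d40).
  have V_bounded M : `|M p q *: V| <= `|V| * `|M|.
    by rewrite normrZ mulrC ler_wpM2l// ler_coord_mx_norm.
  have AE_approx := strict_approxM d40 (ltW d40) (ltW d40) C0 (normr_ge0 V)
    L_bounded V_bounded A0 _ A_approx E_approx.
  have -> : d = d / 4 + d / 4 + d / 4 + d / 4 by field.
  apply: strict_approx_perturb (AE_approx _) _ => [|M].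
    by rewrite mxE scale0r expmx0.
  rewrite /Bbasis_comb big_cons /= [X in X - _]addrC opprD addrACA subrr addr0.
  by rewrite -scalerBr normrZ mulrC ler_pM// ler_coord_mx_norm.
exists (Num.min r 1) => [|M]; first by rewrite lt_min r0 ltr01.
rewrite le_min => /andP[Mr M1].
have -> : A M *m expmx (M p q *: V) *m (X *m expmx W) =
    A M *m P *m (g *m expmx ((M p q + 1) *: W)).
  have -> : expmx (M p q *: V) = X *m expmx (M p q *: W) *m X^T.
    by rewrite /V scalemxAl scalemxAr expmx_conj// ?SO_trmxl// SO_trmxr.
  rewrite expmxDl scale1r -2![in LHS]mulmxA [X^T *m _]mulmxA SO_trmxl// mul1mx.
  by rewrite /X !mulmxA.
apply: (SM _ _ (S_AP _ Mr) (SM _ _ Sg (S_expW _ _))).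
have := le_trans (ler_coord_mx_norm M p q) M1; rewrite ler_norml => /andP[].
by lra.
Qed.

End Chart.

Lemma half_contraction_fixpoint (R : realType) (X : completeNormedModType R) (f : X -> X)
    (r : R) : 0 <= r ->
  (forall x, `|x| <= r -> `|f x| <= r) ->
  (forall x y, `|x| <= r -> `|y| <= r -> `|f x - f y| <= 2^-1 * `|x - y|) ->
  exists2 x, `|x| <= r & x = f x.
Proof.
move=> r0 f_stable f_lip; pose D : set X := [set x | `|x| <= r].
have fD : set_fun D D f by move=> x /f_stable.
pose fHB := isFun.Build _ _ _ _ f fD.
pose g : {fun D >-> D} := HB.pack f fHB.
have [|||x Dx xg] := @banach_fixed_point R X D g.
- exists (2^-1)%:nng; split => /=; first by rewrite invf_lt1// ltr1n.
  by move=> [x y] [Dx Dy]; exact: f_lip.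
- apply: (preimage_closed (D := [set y | y <= r])); last exact: closed_le.
  by move=> x _; exact: norm_continuous.
- by exists 0; rewrite /D /= normr0.
- by exists x.
Qed.

Section SkewPart.
Variables (R : realType) (n : nat).
Implicit Types (Q M Z : 'M[R]_n).

Lemma SO_sym_near1 Q : in_SO Q -> Q^T = Q -> n%:R * `|Q - 1%:M| <= 1 -> Q = 1%:M.
Proof.
move=> QSO Qsym Q_near; apply/eqP; rewrite -subr_eq0; set P := Q - 1%:M in Q_near *.
have PP : P *m P = - (2 *: P).
  have QQ : Q *m Q = 1%:M by rewrite -{2}Qsym SO_trmxr.
  rewrite /P mulmxBr mulmxBl mulmx1 mul1mx QQ.
  by apply/matrixP => i j; rewrite !mxE; ring.
have := ler_mx_normM P P; rewrite PP normrN normrZ ger0_norm// => P_le.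
have : n%:R * `|P| * `|P| <= 1 * `|P| by rewrite ler_wpM2r.
by rewrite -normr_le0; lra.
Qed.

Definition skew M : 'M[R]_n := M - M^T.

Lemma skewB M Z : skew (M - Z) = skew M - skew Z.
Proof. by apply/matrixP => i j; rewrite !mxE; ring. Qed.

Lemma skewD M Z : skew (M + Z) = skew M + skew Z.
Proof. by apply/matrixP => i j; rewrite !mxE; ring. Qed.

Lemma ler_norm_skew M : `|skew M| <= 2 * `|M|.
Proof.
by rewrite (le_trans (ler_normB _ _))// mulr2n mulrDl mul1r lerD2l ler_mx_norm_tr.
Qed.

Lemma trmx_skew M : (skew M)^T = - skew M.
Proof. by rewrite /skew raddfB /= trmxK opprB. Qed.

Lemma skew_skew M : skew (skew M) = 2 *: skew M.
Proof. by apply/matrixP => i j; rewrite !mxE; ring. Qed.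

Lemma skew_sum_Bbasis M :
  Bbasis_comb [seq pq <- enum {: 'I_n * 'I_n} | pq.1 != pq.2] M = skew M.
Proof.
rewrite /Bbasis_comb big_filter big_enum_cond big_mkcond /=.
rewrite (eq_bigr (fun pq => M pq.1 pq.2 *: Bbasis R pq.1 pq.2)) => [|[p q] _ /=]; last first.
  by case: eqVneq => //= ->; rewrite /Bbasis subrr scaler0.
rewrite -(pair_bigA _ (fun p q => M p q *: Bbasis R p q)) /=.
under eq_bigr do under eq_bigr do rewrite /Bbasis scalerBr.
under eq_bigr do rewrite sumrB.
rewrite sumrB -matrix_sum_delta; congr (_ - _).
rewrite [M^T]matrix_sum_delta exchange_big /=.
by apply: eq_bigr => p _; apply: eq_bigr => q _; rewrite mxE.
Qed.

End SkewPart.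

Section LocalSurjectivity.
Variables (R : realType) (n : nat) (A : 'M[R]_n -> 'M[R]_n) (d r : R).
Hypotheses (r_gt0 : 0 < r) (d_ge0 : 0 <= d) (d_small : n%:R * d <= 2^-1).
Hypotheses (A0 : A 0 = 1%:M) (A_SO : forall M, `|M| <= r -> in_SO (A M)).
Hypothesis A_approx : forall M N, `|M| <= r -> `|N| <= r ->
  `|A M - A N - skew (M - N)| <= d * `|M - N|.
Implicit Types (M N Z : 'M[R]_n).

(* A fixed point [M] is skew, so that [A M *m Z^T] is symmetric. *)
Definition newton_step Z M : 'M[R]_n := 2^-1 *: skew M - 4^-1 *: skew (A M *m Z^T).

Lemma newton_step_sub Z M N : in_SO Z ->
  newton_step Z M - newton_step Z N =
  - (4^-1 *: skew (skew (M - N) *m (Z - 1%:M)^T + (A M - A N - skew (M - N)) *m Z^T)).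
Proof.
move=> ZSO; set err := A M - A N - skew (M - N).
set T := skew (M - N) *m _ + _.
have AMN : (A M - A N) *m Z^T = skew (M - N) + T.
  rewrite -[A M - A N](subrK (skew (M - N))) -/err addrC mulmxDl /T addrA; congr (_ + _).
  by rewrite [RHS]addrC [(Z - 1%:M)^T]raddfB /= trmx1 mulmxBr mulmx1 subrK.
have -> : newton_step Z M - newton_step Z N =
    2^-1 *: (skew M - skew N) - 4^-1 *: (skew (A M *m Z^T) - skew (A N *m Z^T)).
  by rewrite /newton_step !scalerBr !opprB addrACA [RHS]addrACA [X in _ + X = _]addrC.
rewrite -!skewB -mulmxBl AMN [skew (_ + T)]skewD skew_skew.
rewrite [4^-1 *: (_ + _)]scalerDr scalerA.
have -> : 4^-1 * 2 = 2^-1 :> R by field.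
by rewrite opprD addrA subrr add0r.
Qed.

Lemma newton_step_lipschitz Z M N :
  in_SO Z -> n%:R * `|Z - 1%:M| <= 4^-1 -> `|M| <= r -> `|N| <= r ->
  `|newton_step Z M - newton_step Z N| <= 2^-1 * `|M - N|.
Proof.
move=> ZSO Z_near1 Mr Nr; rewrite newton_step_sub// normrN normrZ ger0_norm// ler_pdivrMl//.
apply: le_trans (ler_norm_skew _) _; set H := M - N.
have Z_term : `|skew H *m (Z - 1%:M)^T| <= 2^-1 * `|H|.
  apply: le_trans (ler_mx_normM _ _) _.
  rewrite (@le_trans _ _ (n%:R * (2 * `|H|) * `|Z - 1%:M|))//.
    by rewrite ler_pM ?mulr_ge0 ?ler_mx_norm_tr// ler_wpM2l// ler_norm_skew.
  have -> : n%:R * (2 * `|H|) * `|Z - 1%:M| = 2 * (n%:R * `|Z - 1%:M| * `|H|) by ring.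
  by have := ler_wpM2r (normr_ge0 H) Z_near1; lra.
have err_term : `|(A M - A N - skew H) *m Z^T| <= 2^-1 * `|H|.
  apply: le_trans (ler_norm_mulSOr _ (SO_tr ZSO)) _.
  apply: le_trans (ler_wpM2l (ler0n R n) (A_approx Mr Nr)) _.
  by rewrite mulrA ler_wpM2r.
by have := ler_normD (skew H *m (Z - 1%:M)^T) ((A M - A N - skew H) *m Z^T); lra.
Qed.

Lemma ler_norm_newton_step0 Z : `|newton_step Z 0| <= 2^-1 * `|Z - 1%:M|.
Proof.
have -> : newton_step Z 0 = - (4^-1 *: skew (Z - 1%:M)^T).
  rewrite /newton_step A0 mul1mx {1}/skew trmx0 subrr scaler0 add0r.
  by rewrite [(Z - 1%:M)^T]raddfB /= trmx1 skewB {3}/skew trmx1 subrr subr0.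
rewrite normrN normrZ ger0_norm// ler_pdivrMl//.
by have := ler_norm_skew (Z - 1%:M)^T; have := ler_mx_norm_tr (Z - 1%:M); lra.
Qed.

Lemma newton_step_fixpoint_sym Z M :
  M = newton_step Z M -> (A M *m Z^T)^T = A M *m Z^T.
Proof.
move=> M_fix; have M_tr : M^T = - M.
  rewrite [in LHS]M_fix [in RHS]M_fix raddfB /= !linearZ /= !trmx_skew !scalerN.
  by rewrite opprK opprB addrC.
have M_skew : 2^-1 *: skew M = M.
  by rewrite /skew M_tr opprK -mulr2n -[M *+ 2]scaler_nat scalerA mulVf ?scale1r ?pnatr_eq0.
move/eqP: M_fix; rewrite /newton_step M_skew -subr_eq0 opprB addrC subrK.
by rewrite scaler_eq0 invr_eq0 pnatr_eq0 /= subr_eq0 => /eqP.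
Qed.

Lemma SO_chart_surjective : exists2 rho, 0 < rho &
  forall Z, in_SO Z -> `|Z - 1%:M| <= rho -> exists2 M, `|M| <= r & A M = Z.
Proof.
have [rho1 rho10 nrho1] : exists2 rho : R, 0 < rho & n%:R * rho < 4^-1.
  exact: exists_gt0_mul_lt.
have [rho2 rho20 nrho2] : exists2 rho : R, 0 < rho & n%:R ^+ 2 * (3 + d) * rho < 1.
  by apply: exists_gt0_mul_lt; rewrite ?mulr_ge0 ?addr_ge0.
exists (Num.min r (Num.min rho1 rho2)) => [|Z ZSO]; first by rewrite !lt_min r_gt0 rho10.
rewrite !le_min => /andP[Zr /andP[/(ler_wpM2l (ler0n R n)) Z1 Z2]].
have Z_near1 : n%:R * `|Z - 1%:M| <= 4^-1 by apply: le_trans Z1 (ltW nrho1).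
have step_le M : `|M| <= r -> `|newton_step Z M| <= 2^-1 * `|M| + 2^-1 * `|Z - 1%:M|.
  move=> Mr; rewrite -(subrK (newton_step Z 0) (newton_step Z M)).
  rewrite (le_trans (ler_normD _ _))// lerD ?ler_norm_newton_step0//.
  by rewrite -{2}[M]subr0 newton_step_lipschitz// normr0 ltW.
have [|M Mr M_fix] := half_contraction_fixpoint (ltW r_gt0) _
  (fun M N => newton_step_lipschitz ZSO Z_near1 (M := M) (N := N)).
  by move=> M Mr; rewrite (le_trans (step_le M Mr))//; lra.
exists M => //; set Q := A M *m Z^T.
have MZ : `|M| <= `|Z - 1%:M| by have := step_le M Mr; rewrite -M_fix; lra.
have AMZ : `|A M - Z| <= (3 + d) * `|Z - 1%:M|.
  have := @A_approx M 0 Mr; rewrite normr0 !subr0 A0 => /(_ (ltW r_gt0)) AM1.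
  have -> : A M - Z = (A M - 1%:M - skew M) + skew M - (Z - 1%:M).
    by rewrite subrK opprB addrA subrK.
  have := ler_normB (A M - 1%:M - skew M + skew M) (Z - 1%:M).
  have := ler_normD (A M - 1%:M - skew M) (skew M); have := ler_norm_skew M.
  by have := ler_wpM2l d_ge0 MZ; lra.
suff Q1 : Q = 1%:M by rewrite -[A M]mulmx1 -(SO_trmxl ZSO) mulmxA -/Q Q1 mul1mx.
apply: SO_sym_near1; last 1 first.
- have -> : Q - 1%:M = (A M - Z) *m Z^T by rewrite mulmxBl (SO_trmxr ZSO).
  apply: le_trans (ltW nrho2); rewrite expr2 -!mulrA ler_wpM2l//.
  rewrite (le_trans (ler_norm_mulSOr _ (SO_tr ZSO)))// ler_wpM2l//.
  by rewrite (le_trans AMZ)// ler_wpM2l// addr_ge0.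
- by apply: SO_mul; [exact: A_SO|exact: SO_tr].
- exact: newton_step_fixpoint_sym.
Qed.

End LocalSurjectivity.

Lemma dense_semigroup_full (R : realType) (n : nat) (S : set 'M[R]_n) (B0 : 'M[R]_n)
    (a b : 'I_n) :
  SO_semigroup S -> @in_SO R n `<=` closure S -> in_so B0 -> a != b ->
  (forall u t : R, 0 <= t -> S (expmx (t *: (B0 + u *: @Bbasis R n a b)))) ->
  forall Y, in_SO Y -> S Y.
Proof.
move=> semiS denseS soB0 ab S_expmx Y YSO; have [_ SM S_SO] := semiS.
have half_gt0 : 0 < 2^-1 :> R by rewrite invr_gt0.
have [d d0 nd] := exists_gt0_mul_lt (ler0n R n) half_gt0.
pose L := [seq pq <- enum {: 'I_n * 'I_n} | pq.1 != pq.2].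
have L_neq : all (fun pq => pq.1 != pq.2) L by exact: filter_all.
have [A [P [PSO A0 [r1 r10 A_approx] [r2 r20 S_AP]]]] :=
  chart_exists semiS denseS soB0 ab S_expmx d0 L_neq.
pose r := Num.min r1 r2; have r0 : 0 < r by rewrite lt_min r10.
have [rr1 rr2] : r <= r1 /\ r <= r2 by rewrite !ge_min !lexx orbT.
have A_SO M : `|M| <= r -> in_SO (A M).
  move=> Mr; rewrite -[A M]mulmx1 -(SO_trmxr PSO) mulmxA.
  by apply: SO_mul; [apply/S_SO/S_AP/(le_trans Mr)|exact: SO_tr].
have A_skew M N : `|M| <= r -> `|N| <= r ->
    `|A M - A N - skew (M - N)| <= d * `|M - N|.
  by move=> Mr Nr; rewrite -skew_sum_Bbasis A_approx// (le_trans _ rr1).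
have [rho rho0 A_surj] := SO_chart_surjective r0 (ltW d0) (ltW nd) A0 A_SO A_skew.
have [e e0 ne] := exists_gt0_mul_lt (ler0n R n) rho0.
have /closure_normP/(_ e e0)[s Ss YPs] := denseS _ (SO_mul YSO (SO_tr PSO)).
have sSO := S_SO _ Ss.
have [||M Mr AM] := A_surj (s^T *m (Y *m P^T)).
- by apply: SO_mul; [exact: SO_tr|apply: SO_mul => //; exact: SO_tr].
- have -> : s^T *m (Y *m P^T) - 1%:M = s^T *m (Y *m P^T - s).
    by rewrite mulmxBr (SO_trmxl sSO).
  rewrite (le_trans (ler_norm_mulSOl _ (SO_tr sSO)))// (le_trans _ (ltW ne))//.
  by rewrite ler_wpM2l// ltW.
have -> : Y = s *m (A M *m P).
  by rewrite AM !mulmxA SO_trmxr// mul1mx -mulmxA SO_trmxl// mulmx1.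
by apply: SM => //; apply: S_AP; exact: le_trans Mr rr2.
Qed.

Lemma near_eq_cvg_to (U : Type) (V : topologicalType) (F : set_system U) {FF : Filter F}
    (f g : U -> V) (l : V) :
  (\forall x \near F, f x = g x) -> f @ F --> l -> g @ F --> l.
Proof. by move=> fg; apply: cvg_trans; exact: near_eq_cvg. Qed.

Section Concatenation.
Variable R : realType.
Implicit Types (T a b x : R).

Definition concat_at (V : Type) T (f g : R -> V) : R -> V :=
  fun x => if x < T then f x else g x.

Lemma concat_at_lt (V : Type) T (f g : R -> V) x : x < T -> concat_at T f g x = f x.
Proof. by rewrite /concat_at => ->. Qed.

Lemma concat_at_ge (V : Type) T (f g : R -> V) x : T <= x -> concat_at T f g x = g x.
Proof. by rewrite /concat_at leNgt => /negPf ->. Qed.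

Lemma concat_at_le (V : Type) T (f g : R -> V) x :
  f T = g T -> x <= T -> concat_at T f g x = f x.
Proof.
by move=> fgT; rewrite le_eqVlt => /predU1P[->|/concat_at_lt//]; rewrite concat_at_ge.
Qed.

Lemma near_concat_at_lt (V : Type) T (f g : R -> V) x :
  x < T -> \forall y \near x, f y = concat_at T f g y.
Proof.
by move=> xT; near=> y; rewrite concat_at_lt//; near: y; exact: lt_nbhsl.
Unshelve. all: by end_near. Qed.

Lemma near_concat_at_gt (V : Type) T (f g : R -> V) x :
  T < x -> \forall y \near x, g y = concat_at T f g y.
Proof.
by move=> Tx; near=> y; rewrite concat_at_ge// ltW//; near: y; exact: lt_nbhsr.
Unshelve. all: by end_near. Qed.

Lemma within_continuous_concat_at (V : topologicalType) T (f g : R -> V) a b :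
  f T = g T -> a <= T -> T <= b ->
  {within `[a, T], continuous f} -> {within `[T, b], continuous g} ->
  {within `[a, b], continuous (concat_at T f g)}.
Proof.
move=> fgT aT Tb f_cont g_cont.
have -> : `[a, b]%classic = `[a, T]%classic `|` `[T, b]%classic.
  apply/seteqP; split=> x /=; rewrite !in_itv /=.
    by move=> /andP[-> ->]; rewrite andbT; exact/orP/le_total.
  by move=> [/andP[-> /le_trans->]|/andP[/(le_trans aT)-> ->]].
apply: withinU_continuous; [exact: itv_closed|exact: itv_closed| |].
  apply: subspace_eq_continuous f_cont => x.
  by rewrite inE /= in_itv /= => /andP[_ xT]; rewrite /from_subspace concat_at_le.
apply: subspace_eq_continuous g_cont => x.
by rewrite inE /= in_itv /= => /andP[Tx _]; rewrite /from_subspace concat_at_ge.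
Qed.

Lemma piecewise_continuous_continuous (u : R -> R) T :
  continuous u -> piecewise_continuous u T.
Proof.
move=> u_cont; exists [::]; split; first by move=> t _ _; exact: u_cont.
split=> t _; exists (u t); first exact/cvg_at_right_filter/u_cont.
exact/cvg_at_left_filter/u_cont.
Qed.

Lemma piecewise_continuous_concat_at (u v : R -> R) T a :
  piecewise_continuous u T -> continuous v ->
  piecewise_continuous (concat_at T u v) (T + a).
Proof.
move=> [s [u_cont [u_right u_left]]] v_cont; exists (T :: s); split; [|split].
- move=> x /andP[x0 xTa]; rewrite inE negb_or => /andP[xT xs].
  move: xT; rewrite neq_lt => /orP[xT|Tx].
    rewrite concat_at_lt//; apply: near_eq_cvg_to (u_cont x _ xs); last by rewrite x0.
    exact: near_concat_at_lt.
  rewrite concat_at_ge ?ltW//; apply: near_eq_cvg_to (v_cont x).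
  exact: near_concat_at_gt.
- move=> x /andP[x0 xTa]; have [xT|Tx] := ltP x T.
    have [|l u_l] := u_right x; first by rewrite x0.
    exists l; apply: near_eq_cvg_to u_l.
    exact: cvg_within (near_concat_at_lt _ _ xT).
  exists (v x); apply: near_eq_cvg_to (cvg_at_right_filter (v_cont x)).
  near=> y; have xy : x < y by near: y; exact: nbhs_right_gt.
  by rewrite concat_at_ge// (le_trans Tx)// ltW.
- move=> x /andP[x0 xTa]; have [xT|Tx] := leP x T.
    have [|l u_l] := u_left x; first by rewrite x0.
    exists l; apply: near_eq_cvg_to u_l; near=> y.
    have yx : y < x by near: y; exact: nbhs_left_lt.
    by rewrite concat_at_lt// (lt_le_trans yx).
  exists (v x); apply: near_eq_cvg_to (cvg_at_left_filter (v_cont x)).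
  exact: cvg_within (near_concat_at_gt _ _ Tx).
Unshelve. all: by end_near. Qed.

End Concatenation.

Section Reachability.
Variables (R : realType) (n m : nat) (B0 : 'M[R]_n) (Bs : 'I_m -> 'M[R]_n).
Hypotheses (soB0 : in_so B0) (soBs : forall k, in_so (Bs k)).
Implicit Types (X Y : 'M[R]_n) (t T : R) (c : 'I_m -> R).

Definition control_field c : 'M[R]_n := B0 + \sum_(k < m) c k *: Bs k.

Inductive reach : 'M[R]_n -> Prop :=
| reach1 : reach 1%:M
| reachM c t Y : 0 <= t -> reach Y -> reach (expmx (t *: control_field c) *m Y).

Lemma so_control_field c : in_so (control_field c).
Proof. by apply: soD => //; apply: so_sum => k _; exact: soZ. Qed.

Lemma reach_expmx c t : 0 <= t -> reach (expmx (t *: control_field c)).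
Proof. by move=> t0; rewrite -[expmx _]mulmx1; exact: reachM reach1. Qed.

Lemma reach_semigroup : SO_semigroup reach.
Proof.
split; first exact: reach1.
  move=> X Y; elim=> [|c t Z t0 _ IH] hY; first by rewrite mul1mx.
  by rewrite -mulmxA; apply: reachM => //; exact: IH.
move=> X; elim=> [|c t Y t0 _ YSO]; first exact: SO1.
by apply: SO_mul => //; apply: SO_expmx; apply: soZ; exact: so_control_field.
Qed.

Lemma control_field_single k (v : R) :
  control_field (fun l => if l == k then v else 0) = B0 + v *: Bs k.
Proof.
rewrite /control_field (bigD1 k) //= eqxx big1 ?addr0 // => l lk.
by rewrite (negPf lk) scale0r.
Qed.

Lemma is_trajectory_concat_at (u : 'I_m -> R -> R) T (X : R -> 'M[R]_n) c t :
  0 <= T -> 0 <= t -> is_trajectory B0 Bs u T X ->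
  is_trajectory B0 Bs (fun k => concat_at T (u k) (fun=> c k)) (T + t)
    (concat_at T X (fun x =>
      expmx (x *: control_field c) *m (expmx (- T *: control_field c) *m X T))).
Proof.
move=> T0 t0 [X0 [XSO [Xc [s Xd]]]]; set W := control_field c.
set Z := (fun x : R => _ *m _).
have soW : in_so W by exact: so_control_field.
have ZT : X T = Z T by rewrite /Z mulmxA -expmxDl subrr scale0r expmx0 mul1mx.
have dZ (x : R) : is_derive x 1 Z (W *m Z x).
  by rewrite /Z mulmxA; apply: is_derive_mulmxr; exact: is_derive_expmx.
split; first by rewrite concat_at_le.
split.
  move=> x /andP[x0 xT]; have [xle|/ltW xge] := leP x T.
    by rewrite concat_at_le//; apply: XSO; rewrite x0.
  rewrite concat_at_ge//; apply: SO_mul; first exact/SO_expmx/soZ.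
  by apply: SO_mul; [exact/SO_expmx/soZ|apply: XSO; rewrite T0 lexx].
split.
  move=> i j.
  have -> : (fun x => concat_at T X Z x i j) =
      concat_at T (fun x => X x i j) (fun x => Z x i j).
    by apply/funext => x; rewrite /concat_at; case: ifP.
  apply: within_continuous_concat_at => //; [by rewrite ZT|by rewrite lerDl|].
  apply: continuous_subspaceT => x.
  apply/differentiable_continuous/derivable1_diffP.
  by have /is_derive_mxP/(_ i j)[] := dZ x.
exists (T :: s) => x /andP[x0 xTt]; rewrite inE negb_or => /andP[xT xs] i j.
move: xT; rewrite neq_lt => /orP[xT|Tx].
  rewrite concat_at_lt//; under eq_bigr do rewrite concat_at_lt//.
  apply: near_eq_is_derive (Xd x _ xs i j); last by rewrite x0.
  by apply: filterS (near_concat_at_lt X Z xT) => y ->.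
rewrite concat_at_ge ?ltW//; under eq_bigr do rewrite concat_at_ge ?ltW//.
have /is_derive_mxP/(_ i j) := dZ x; apply: near_eq_is_derive.
by apply: filterS (near_concat_at_gt X Z Tx) => y ->.
Qed.

Lemma attainable1 : attainable B0 Bs 1%:M.
Proof.
exists 0, (fun _ _ => 0), (fun=> 1%:M); split=> //; split.
  by move=> k; apply: piecewise_continuous_continuous => x; exact: cvg_cst.
split=> //; split=> //; split; first by move=> x _; exact: SO1.
split; first by move=> i j; apply: continuous_subspaceT => x; exact: cvg_cst.
by exists [::] => x /andP[x0 x1]; have := lt_trans x0 x1; rewrite ltxx.
Qed.

Lemma attainable_expmx c t Y : 0 <= t -> attainable B0 Bs Y ->
  attainable B0 Bs (expmx (t *: control_field c) *m Y).
Proof.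
move=> t0 [T [u [X [T0 [u_pc [trX <-]]]]]].
have trXE := is_trajectory_concat_at c T0 t0 trX.
exists (T + t); do 2!eexists; split; last split; last (split; first exact: trXE).
- exact: addr_ge0.
- by move=> k; apply: piecewise_continuous_concat_at => // x; exact: cvg_cst.
- by rewrite concat_at_ge ?lerDl// mulmxA -expmxDl addrAC subrr add0r.
Qed.

Lemma reach_attainable Y : reach Y -> attainable B0 Bs Y.
Proof. by elim=> [|c t Z t0 _]; [exact: attainable1|exact: attainable_expmx]. Qed.

End Reachability.

Lemma exists_nonroot (F : numDomainType) (p : {poly F}) : p != 0 -> exists x, ~~ root p x.
Proof.
move=> p0; pose xs : seq F := [seq k%:R | k <- iota 0 (size p)].
have uniq_xs : uniq xs.
  by rewrite map_inj_uniq ?iota_uniq // => k l /eqP; rewrite eqr_nat => /eqP.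
have : ~~ all (root p) xs.
  apply/negP => roots_xs; have := max_poly_roots p0 roots_xs uniq_xs.
  by rewrite size_map size_iota ltnn.
by move=> /allPn[x _ px]; exists x.
Qed.

Lemma exists_common_nonroot (F : numDomainType) (I : finType) (P : I -> {poly F}) :
  exists2 x : F, x != 0 & forall i, P i != 0 -> ~~ root (P i) x.
Proof.
have [|x] := @exists_nonroot F ('X * \prod_(i | P i != 0) P i).
  by rewrite mulf_neq0 ?polyX_eq0 //; exact/prodf_neq0.
rewrite rootM rootX negb_or => /andP[x0 nroot_prod]; exists x => // i Pi0.
apply: contra nroot_prod => root_Pi.
by rewrite rootE horner_prod; apply/prodf_eq0; exists i.
Qed.

Section GenericDrift.
Variables (R : realType) (n : nat).
Implicit Types (As : seq 'M[R]_n) (i j : 'I_n).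

Definition entry_poly As i j : {poly R} := \poly_(k < size As) nth 0 As k i j.

Lemma entry_poly_neq0 As A i j : A \in As -> A i j != 0 -> entry_poly As i j != 0.
Proof.
move=> AAs; apply: contraNneq => /polyP/(_ (index A As)).
by rewrite coef0 coef_poly index_mem AAs nth_index // => ->.
Qed.

Lemma horner_entry_poly As i j x : uniq As ->
  (entry_poly As i j).[x] = (\sum_(A <- As) x ^+ index A As *: A) i j.
Proof.
move=> uAs; rewrite horner_poly (big_nth 0) big_mkord summxE; apply: eq_bigr => k _.
by rewrite mxE mulrC index_uniq.
Qed.

Lemma generic_drift As : (forall A, A \in As -> in_so A) ->
  exists B0, [/\ rigid_pattern As B0, in_so B0 &
    forall i j, drift_rel As i j -> B0 i j != 0].
Proof.
move=> soAs; pose U := undup As.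
have [x x0 x_nroot] := exists_common_nonroot (fun ij => entry_poly U ij.1 ij.2).
exists (\sum_(A <- U) x ^+ index A U *: A); split.
- by exists (fun A => x ^+ index A U); split=> // A _; rewrite expf_neq0.
- by rewrite big_seq; apply: so_sum => A; rewrite mem_undup => /soAs; exact: soZ.
- move=> i j /andP[_ /hasP[A AAs Aij]].
  rewrite -horner_entry_poly ?undup_uniq //; apply: (x_nroot (i, j)).
  by apply: entry_poly_neq0 Aij; rewrite mem_undup.
Qed.

End GenericDrift.

Lemma components_ge3_edge n (E : seq ('I_n * 'I_n)) (i : 'I_n) :
  components_ge3 (contr_rel E) -> exists p, p \in E.
Proof.
move=> /(components_ge3_triple i)[j [j2 [/connectP[p path_p ->] _ /=]]].
case: p path_p => [|k p /= /andP[/andP[_ ik] _] _]; first by rewrite !inE eqxx.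
by case/orP: ik => ikE; [exists (i, k)|exists (k, i)].
Qed.

Lemma mem_free_pattern (R : realType) n (gs : seq 'M[R]_n) g :
  g \in gs -> free_pattern gs g.
Proof.
move=> ggs; exists (fun h => (h == g)%:R).
rewrite (bigD1_seq g) ?undup_uniq ?mem_undup //= eqxx scale1r big1 ?addr0 //.
by move=> h /negPf ->; rewrite scale0r.
Qed.

Section Controllability.
Variables (R : realType) (n : nat) (B0 : 'M[R]_n) (E : seq ('I_n * 'I_n)).
Hypotheses (soB0 : in_so B0) (E_neq : forall p, p \in E -> p.1 != p.2).
Local Notation B := (@Bbasis R n).

Definition edge_control (k : 'I_(size E)) : 'M[R]_n :=
  B (tnth (in_tuple E) k).1 (tnth (in_tuple E) k).2.

Local Notation reachable := (reach B0 edge_control : set 'M[R]_n).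

Lemma edge_control_semigroup : SO_semigroup reachable.
Proof. by apply: reach_semigroup => // k; exact: so_Bbasis. Qed.

Lemma reach_edge p u t : p \in E -> 0 <= t ->
  reachable (expmx (t *: (B0 + u *: B p.1 p.2))).
Proof.
move=> /(tnthP (in_tuple E))[k ->] t0.
by rewrite -[B _ _]/(edge_control k) -control_field_single; exact: reach_expmx.
Qed.

Lemma liealg_reach_edge p u : p \in E ->
  liealg (closure reachable) (B0 + u *: B p.1 p.2).
Proof.
move=> pE; apply: liealg_pos.
- exact: closed_closure.
- exact/SO_semigroup_closure/edge_control_semigroup.
- by apply: soD => //; apply: soZ; exact: so_Bbasis.
- by move=> t t0; apply: subset_closure; exact: reach_edge.
Qed.

Lemma reach_dense p : p \in E -> components_ge3 (contr_rel E) ->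
  graph_connected (union_rel (fun i j => B0 i j != 0) (contr_rel E)) ->
  @in_SO R n `<=` closure reachable.
Proof.
move=> pE comp3 conn; set K := closure _.
have closedK : closed K by exact: closed_closure.
have semiK : SO_semigroup K by exact/SO_semigroup_closure/edge_control_semigroup.
have K_B0 : liealg K B0 by have := liealg_reach_edge (u := 0) pE; rewrite scale0r addr0.
have K_edge q : q \in E -> liealg K (B q.1 q.2).
  move=> /(liealg_reach_edge (u := 1)); rewrite scale1r => K_B0q.
  by rewrite -(addKr B0 (B _ _)) addrC; exact: liealgB.
have K_contr i j : contr_rel E i j -> liealg K (B i j).
  by move=> /andP[_ /orP[]] /K_edge => [|/liealg_Bbasis_sym]; exact.
exact: closed_semigroup_full closedK semiK
  (liealg_Bbasis_all closedK semiK comp3 conn K_B0 K_contr).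
Qed.

Lemma controllable_edges p : p \in E -> components_ge3 (contr_rel E) ->
  graph_connected (union_rel (fun i j => B0 i j != 0) (contr_rel E)) ->
  controllable_SO B0 edge_control.
Proof.
move=> pE comp3 conn Y YSO; apply: reach_attainable => // [k|]; first exact: so_Bbasis.
have denseE := reach_dense pE comp3 conn.
apply: (dense_semigroup_full edge_control_semigroup denseE soB0 (E_neq pE)) YSO.
by move=> u t; exact: reach_edge.
Qed.

End Controllability.

Theorem theorem1 (R : realType) (n : nat) (As : seq 'M[R]_n) (E : seq ('I_n * 'I_n)) :
  (2 <= n)%N ->
  (1 <= size As)%N ->
  (forall A, A \in As -> in_so A) ->
  (forall p, p \in E -> (p.1 < p.2)%N) ->
  components_ge3 (contr_rel E) ->
  graph_connected (union_rel (drift_rel As) (contr_rel E)) ->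
  structurally_controllable_SO As [seq @Bbasis R n p.1 p.2 | p <- E].
Proof.
move=> n2 _ soAs ltE comp3 conn.
have [B0 [B0_rigid soB0 B0_edge]] := generic_drift soAs.
have [p pE] := components_ge3_edge (Ordinal (ltnW n2)) comp3.
exists (size E), B0, (@edge_control R n E); split; first by case: (E) pE.
split; first exact: B0_rigid.
split=> [k|].
  by apply: mem_free_pattern; apply: map_f; exact: mem_tnth.
apply: (controllable_edges soB0 _ pE comp3) => [q /ltE|i j].
  by rewrite neq_ltn => ->.
apply: connect_sub (conn i j) => k l /orP[kl|kl]; apply: connect1; apply/orP.
  by left; exact: B0_edge.
by right.
Qed.
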